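(* Let $k\geq 1$, $n\geq 3$, and let $\Gamma$ be an Abelian group of order $n(k+1)$. Suppose $\Gamma$ has a subgroup $H$ of order $n$ such that either $n$ is odd, or $n$ is even and $H$ has a subgroup isomorphic to $Z_2\oplus Z_{2s}$ for some $s\geq 2$. Then the superwheel $SW_{k,n}$ is $\Gamma$-harmonious.
   Context: The superwheel $SW_{k,n}$ is the graph obtained from the cycle $C_n$ by adding $k$ new vertices, pairwise non-adjacent, each joined by an edge to every vertex of $C_n$; it has $(k+1)n$ edges. For a graph $G=(V,E)$ with $q$ edges and a finite Abelian group $\Gamma$ of order $q$ (written additively), $G$ is called $\Gamma$-harmonious if there is an injection $f:V\to\Gamma$ such that the induced edge labeling $w(xy)=f(x)+f(y)$ is a bijection from $E$ to $\Gamma$. $Z_k$ denotes the cyclic group of order $k$. *)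

(* Defs.v *)
From mathcomp Require Import all_boot all_order all_algebra all_fingroup.

Set Implicit Arguments.
Unset Strict Implicit.
Unset Printing Implicit Defensive.

Import GRing.Theory.
Local Open Scope ring_scope.

Record sgraph := SGraph {
  vertex :> finType;
  adj : rel vertex;
  adj_sym : symmetric adj;
  adj_irrefl : irreflexive adj }.

Definition edges (G : sgraph) : {set {set G}} :=
  [set [set p.1; p.2] | p : G * G & adj p.1 p.2].

(* [ordS i] is i + 1 modulo n.  The condition [i != j] only matters for n = 1,
   where [ordS i = i]; for n >= 3 this is the cycle C_n. *)
Definition cycle_adj (n : nat) : rel 'I_n :=
  fun i j => (i != j) && ((j == ordS i) || (i == ordS j)).

(* [inl i] is the i-th vertex of C_n, and [inr j] is the j-th of the k added
   vertices. *)
Definition superwheel_adj (k n : nat) : rel ('I_n + 'I_k)%type :=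
  fun x y =>
    match x, y with
    | inl i, inl j => cycle_adj i j
    | inl _, inr _ => true
    | inr _, inl _ => true
    | inr _, inr _ => false
    end.

Lemma superwheel_adj_sym (k n : nat) : symmetric (@superwheel_adj k n).
Proof.
by case=> [i|i] [j|j] //=; rewrite /cycle_adj eq_sym orbC.
Qed.

Lemma superwheel_adj_irrefl (k n : nat) : irreflexive (@superwheel_adj k n).
Proof. by case=> i //=; rewrite /cycle_adj eqxx. Qed.

Definition superwheel (k n : nat) : sgraph :=
  SGraph (@superwheel_adj_sym k n) (@superwheel_adj_irrefl k n).

(* An edge {x, y} is an unordered pair, so f x + f y is written as the sum of
   f over the two endpoints; see [edge_labelE]. *)
Definition edge_label (G : sgraph) (Gamma : finZmodType) (f : G -> Gamma)
  (e : {set G}) : Gamma := \sum_(v in e) f v.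

Lemma edge_labelE (G : sgraph) (Gamma : finZmodType) (f : G -> Gamma)
  (x y : G) : adj x y -> edge_label f [set x; y] = f x + f y.
Proof.
move=> xy; have x_neq_y : x != y.
  by apply: contraTneq xy => ->; rewrite adj_irrefl.
by rewrite /edge_label big_setU1 ?big_set1 // inE.
Qed.

(* The last two conditions say that the edge labeling is a bijection from
   [edges G] onto Gamma; in particular #|Gamma| is the number of edges, see
   [harmonious_card]. *)
Definition harmonious (G : sgraph) (Gamma : finZmodType) : Prop :=
  exists f : G -> Gamma,
    [/\ injective f,
        {in edges G &, injective (edge_label f)} &
        edge_label f @: edges G = [set: Gamma] ].

Lemma harmonious_card (G : sgraph) (Gamma : finZmodType) :
  harmonious G Gamma -> #|edges G| = #|Gamma|.
Proof.
by case=> f [_ w_inj w_surj]; rewrite -(card_in_imset w_inj) w_surj cardsT.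
Qed.

(* Main.v *)
Require Import Defs.
From mathcomp Require Import all_boot all_order all_algebra all_fingroup.
From mathcomp Require Import all_solvable all_field.
From mathcomp Require Import zify ring.

(* Label the cycle by H and the added vertices by representatives of the nonzero
   cosets of H: the edges at an added vertex receive its coset, and it remains to
   arrange H in a cycle in which consecutive sums are distinct.  Write H = P + O
   with P the 2-part and O the odd part.
   - An odd direct factor N is harmless: if G and N have such cycles c and s, walk
     c repeatedly, adding s_r to it in the r-th round; sums on one edge of c
     change by 2 s_r, and doubling is injective on N.  This settles odd order.
   - If P is not elementary abelian, induct on |P| with subgroups K such that
     P / K is a Klein group: a cycle on K and one on P minus K are joined by
     exchanging four edges.  The base cases are Z_2 + Z_(2^b), Z_4 + Z_4 and
     Z_4 + Z_2 + Z_2.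
   - If P is elementary abelian, then O has a cyclic direct factor Z_q with
     q > 1.  Identify P with a finite field F; again a cycle on 0 * Z_q and one
     on F^* * Z_q are joined by exchanging four edges. *)

Set Implicit Arguments.
Unset Strict Implicit.
Unset Printing Implicit Defensive.

Import GRing.Theory.
Local Open Scope ring_scope.

(** * Cyclic sequences with distinct consecutive sums *)

Section ZmodGroups.
Variables (U : finZmodType) (G : {group U}).

Lemma zgroupD x y : x \in G -> y \in G -> x + y \in G.
Proof. exact: groupM. Qed.
Lemma zgroupN x : (- x \in G) = (x \in G).
Proof. exact: groupV. Qed.
Lemma zgroupDr x y : x \in G -> (y + x \in G) = (y \in G).
Proof. exact: groupMr. Qed.
Lemma zgroupDl x y : x \in G -> (x + y \in G) = (y \in G).
Proof. exact: groupMl. Qed.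
Lemma zgroupMn x n : x \in G -> x *+ n \in G.
Proof. by rewrite -FinRing.zmodXgE; apply: groupX. Qed.
End ZmodGroups.

(* The elements of G can be arranged in a cycle with distinct consecutive sums. *)
Definition harmonious_set (U : finZmodType) (G : {set U}) : Prop :=
  exists g : nat -> U,
    [/\ g #|G| = g 0%N,
        forall i, (i < #|G|)%N -> g i \in G,
        forall i j, (i < #|G|)%N -> (j < #|G|)%N -> g i = g j -> i = j &
        forall i j, (i < #|G|)%N -> (j < #|G|)%N ->
          g i + g i.+1 = g j + g j.+1 -> i = j].

Section Sequences.
Variable U : zmodType.
Implicit Types (x y : U) (s t : seq U).

Definition path_sums s := if s is x :: t then pairmap +%R x t else [::].
Definition cycle_sums s := if s is x :: t then pairmap +%R x (rcons t x) else [::].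

Lemma path_sums_map (c : nat -> U) a m :
  path_sums (map c (iota a m.+1)) = [seq c i + c i.+1 | i <- iota a m].
Proof.
elim: m a => //= m IHm a; congr (_ :: _); exact: (IHm a.+1).
Qed.

Lemma cycle_sums_mkseq (c : nat -> U) n : c n = c 0%N ->
  cycle_sums (mkseq c n) = mkseq (fun i => c i + c i.+1) n.
Proof.
case: n => // n cn; rewrite /mkseq -path_sums_map.
have -> : iota 0 n.+2 = rcons (iota 0 n.+1) n.+1 by rewrite -cats1 -[n.+2]addn1 iotaD.
by rewrite map_rcons cn.
Qed.

Lemma path_sums_cat x s y t :
  path_sums ((x :: s) ++ y :: t) =
    path_sums (x :: s) ++ (last x s + y) :: path_sums (y :: t).
Proof. by rewrite /= pairmap_cat. Qed.

Lemma path_sums_rev s : path_sums (rev s) = rev (path_sums s).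
Proof.
elim: s => // x [|y s] // IHs.
have -> : path_sums (x :: y :: s) = (x + y) :: path_sums (y :: s) by [].
rewrite rev_cons [RHS]rev_cons -{}IHs rev_cons.
case: (rev s) => [|z t] /=; first by rewrite addrC.
by rewrite -!cats1 !pairmap_cat last_cat /= [y + x]addrC.
Qed.

Lemma cycle_sums_cat x s y t :
  cycle_sums ((x :: s) ++ y :: t) =
    path_sums (x :: s) ++ (last x s + y) :: rcons (path_sums (y :: t)) (last y t + x).
Proof.
rewrite /= rcons_cat pairmap_cat /=; congr (_ ++ _ :: _).
by rewrite -!cats1 pairmap_cat.
Qed.

Lemma nth_cycle_sums s i : (i < size s)%N ->
  nth 0 (cycle_sums s) i = nth 0 s i + nth 0 s (i.+1 %% size s).
Proof.
case: s => // x s lti; rewrite /cycle_sums (nth_pairmap 0) ?size_rcons //.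
rewrite -rcons_cons nth_rcons lti; congr (_ + _).
rewrite nth_rcons; move: lti; rewrite /= ltnS leq_eqVlt => /predU1P[->|lti].
  by rewrite ltnn eqxx modnn.
by rewrite lti modn_small.
Qed.

Lemma size_cycle_sums s : size (cycle_sums s) = size s.
Proof. by case: s => // x s; rewrite /= size_pairmap size_rcons. Qed.

End Sequences.

Lemma seq_harm (U : finZmodType) (G : {set U}) (s : seq U) :
  uniq s -> s =i G -> uniq (cycle_sums s) -> harmonious_set G.
Proof.
move=> us sG ucs.
have sz : #|G| = size s by rewrite -(eq_card sG) (card_uniqP us).
exists (fun i => nth 0 s (i %% size s)); rewrite sz.
split=> [|i lti|i j lti ltj|i j lti ltj]; first by rewrite modnn mod0n.
- by rewrite -sG modn_small ?mem_nth.
- by rewrite !modn_small // => /eqP; rewrite nth_uniq // => /eqP.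
rewrite [(i %% _)%N]modn_small // [(j %% _)%N]modn_small // -!nth_cycle_sums //.
by move=> /eqP; rewrite nth_uniq ?size_cycle_sums // => /eqP.
Qed.

Section Harm.
Variables (U : finZmodType) (G : {group U}).

(** Extending the arrangement periodically allows shifted indices, with equality of indices replaced
    by congruence modulo [#|G|]. *)
Lemma harm_periodic : harmonious_set G ->
  exists g : nat -> U,
    [/\ forall i, g i \in G,
        forall i, g (i %% #|G|)%N = g i,
        forall i j, g i = g j -> i = j %[mod #|G|] &
        forall i j, g i + g i.+1 = g j + g j.+1 -> i = j %[mod #|G|]].
Proof.
case=> g [gn gG ginj sinj].
have G0 : (0 < #|G|)%N := cardG_gt0 G.
have ltm i : (i %% #|G| < #|G|)%N by rewrite ltn_mod.
have gS i : g (i.+1 %% #|G|)%N = g (i %% #|G|).+1.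
  rewrite -[i.+1]addn1 -modnDml addn1.
  have := ltm i; rewrite leq_eqVlt => /predU1P[->|lti]; last by rewrite modn_small.
  by rewrite modnn gn.
exists (fun i => g (i %% #|G|)%N); split=> [i|i|i j|i j].
- exact: gG.
- by rewrite modn_mod.
- exact: ginj.
- by rewrite !gS; apply: sinj.
Qed.

(** A counting argument. Applied to consecutive sums, it finds the edge of a cycle that carries a
    prescribed sum. *)
Lemma periodic_surj (f : nat -> U) :
    (forall i, f i \in G) ->
    (forall i j, f i = f j -> i = j %[mod #|G|]) ->
  forall x, x \in G -> exists2 i, (i < #|G|)%N & f i = x.
Proof.
move=> fG finj x xG.
have injf : injective (fun i : 'I_#|G| => f i).
  by move=> i j /finj; rewrite !modn_small // => /val_inj.
have : [set f i | i : 'I_#|G|] = G.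
  apply/eqP; rewrite eqEcard card_imset // card_ord leqnn andbT.
  by apply/subsetP=> _ /imsetP[i _ ->].
by move/setP/(_ x); rewrite xG => /imsetP[i _ ->]; exists i.
Qed.

End Harm.

(** * Odd direct factors *)

Lemma eqn_mod_mul a b i j :
  i = j %[mod a] -> (i %/ a = j %/ a %[mod b])%N -> i = j %[mod b * a].
Proof.
move=> eq1 eq2; have dvd_a : (a %| b * a)%N by apply: dvdn_mull.
rewrite (divn_eq (i %% (b * a)) a) -modn_divl eq2 modn_divl.
by rewrite modn_dvdm // eq1 -(modn_dvdm j dvd_a) -divn_eq.
Qed.

Section Direct.
Variable U : finZmodType.
Implicit Types G N H : {group U}.

Lemma odd_double_eq0 N y : odd #|N| -> y \in N -> y *+ 2 = 0 -> y = 0.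
Proof.
move=> oddN yN y2; apply/eqP; rewrite -[0]/(1%g : U) -order_eq1.
have : (#[y]%g %| gcdn #|N| 2)%N.
  rewrite dvdn_gcd order_dvdG // order_dvdn.
  by apply/eqP.
have /eqP -> : coprime #|N| 2 by rewrite coprimen2.
by rewrite dvdn1.
Qed.

Lemma dprod_zmodP G1 N H : (G1 \x N)%g = H ->
  [/\ #|H| = (#|G1| * #|N|)%N, G1 \subset H, N \subset H &
      forall x x' y y', x \in G1 -> x' \in G1 -> y \in N -> y' \in N ->
        x + y = x' + y' -> x = x' /\ y = y'].
Proof.
move=> defH; have cardH := dprod_card defH.
case/dprodP: defH => _ defH _ tiH.
split=> //; [by rewrite -defH mulG_subl | by rewrite -defH mulG_subr |].
move=> x x' y y' xG xG' yN yN' eqxy.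
have eqd : x - x' = y' - y.
  by apply: (addIr y); rewrite subrK addrAC eqxy addrAC subrr add0r.
have : x - x' \in (G1 :&: N)%g.
  by rewrite inE {2}eqd !zgroupD ?zgroupN.
rewrite tiH => /set1P/eqP; rewrite subr_eq0 => /eqP xx'; split=> //.
by move: eqxy; rewrite xx' => /addrI.
Qed.

Lemma harm_dprod G1 N H : (G1 \x N)%g = H -> odd #|N| ->
  harmonious_set G1 -> harmonious_set N -> harmonious_set H.
Proof.
move=> defH oddN /harm_periodic[c [cG cmod cinj csum]] /harm_periodic[s [sN smod sinj ssum]].
have [cardH sG1 sN1 uniqH] := dprod_zmodP defH.
set a := #|G1| in cmod cinj csum cardH; set b := #|N| in smod sinj ssum cardH.
have a0 : (0 < a)%N := cardG_gt0 _.
have modab i j : (i < #|H|)%N -> (j < #|H|)%N ->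
    i = j %[mod a] -> (i %/ a = j %/ a %[mod b])%N -> i = j.
  rewrite cardH mulnC => lti ltj e1 e2.
  by have := eqn_mod_mul e1 e2; rewrite !modn_small.
exists (fun i => c i + s (i %/ a)%N); split=> [|i lti|i j lti ltj|i j lti ltj].
- by rewrite cardH mulKn // div0n -(cmod (a * b)%N) -(smod b) modnMr modnn.
- by rewrite zgroupD ?(subsetP sG1 _ (cG _)) ?(subsetP sN1 _ (sN _)).
- by case/uniqH=> // /cinj e1 /sinj e2; apply: modab.
rewrite addrACA [RHS]addrACA => /uniqH[]; rewrite ?zgroupD //.
move=> /csum e1 e2; apply: modab => //.
(* The round changes only at multiples of [a], and by [e1] this happens for [i] and [j] together.
   Either both steps pass to the next round, and [ssum] applies, or both stay in their rounds and
   contribute doubles, which are distinct in odd order. *)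
have dS k : (k.+1 %/ a = k %/ a + (k.+1 %% a == 0))%N.
  by rewrite divnS // addnC.
have eS : i.+1 = j.+1 %[mod a] by rewrite -addn1 -modnDml e1 modnDml addn1.
move: e2; rewrite !dS eS; case: (_ == _) => /=.
  by rewrite !addn1 => /ssum.
rewrite !addn0 -!mulr2n => e2; apply: sinj; apply/eqP; rewrite -subr_eq0.
by apply/eqP/(odd_double_eq0 oddN); rewrite ?zgroupD ?zgroupN // mulrnBl e2 subrr.
Qed.

(** In the natural order of the multiples of [x] the sums are the odd multiples (2i + 1)x, and
    doubling is injective in odd order. *)
Lemma cycle_harm (x : U) : odd #[x]%g -> harmonious_set <[x]>%g.
Proof.
move=> oddx; exists (fun i => x *+ i); rewrite -orderE.
have x0 : x *+ #[x]%g = 0 by apply: expg_order.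
have xinj i j : (i < #[x]%g)%N -> (j < #[x]%g)%N -> x *+ i = x *+ j -> i = j.
  move=> lti ltj /eqP; rewrite -!FinRing.zmodXgE eq_expg_mod_order.
  by rewrite !modn_small // => /eqP.
split=> [|i _|i j lti ltj|i j lti ltj].
- by rewrite mulr0n.
- by apply: mem_cycle.
- exact: xinj.
rewrite -!mulrnDr !addnS !addnn !mulrS => /addrI eq2; apply: xinj => //.
apply/eqP; rewrite -subr_eq0; apply/eqP/(odd_double_eq0 (N := <[x]>)) => //.
  by rewrite zgroupD ?zgroupN //; apply: mem_cycle.
by rewrite mulrnBl -!mulrnA !muln2 eq2 subrr.
Qed.

(** A cyclic subgroup whose order is the exponent is a direct factor. Splitting repeatedly gives
    cyclic factors whose orders successively divide each other. *)
Lemma cycle_split H : exists (x : U) (N : {group U}),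
  [/\ #[x]%g = exponent H & (<[x]> \x N)%g = H].
Proof.
have abH : abelian H := FinRing.zmod_abelian H.
have [N /(_ abH)[x ox defH]] := abelian_type_subproof H.
by exists x, N.
Qed.

Lemma odd_harm N : odd #|N| -> harmonious_set N.
Proof.
have [n] := ubnP #|N|; elim: n => // n IHn in N * => leNn oddN.
have [x [L [ox defN]]] := cycle_split N.
have [cardN sx sL _] := dprod_zmodP defN.
have [oddx oddL] : odd #[x]%g /\ odd #|L| by apply/andP; rewrite -oddM -cardN.
have [x1|ntx] := leqP #[x]%g 1.
  have /eqP defN1 : N :==: 1%g.
    by rewrite trivg_exponent -ox dvdn1 eqn_leq x1 order_gt0.
  have -> : N = <[1%g : U]>%G by apply/val_inj; rewrite /= cycle1.
  by apply: cycle_harm; rewrite order1.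
apply: (harm_dprod defN) => //; first exact: cycle_harm.
by apply: IHn => //; rewrite -ltnS (leq_trans _ leNn) // ltnS cardN ltn_Pmull.
Qed.
End Direct.

(** * Exchanging four edges *)

(* Two cycles, one of them cut at one place and the other at three places, are
   reconnected into one; the last two lemmas correspond to the two ways of doing
   this in which one path is reversed. *)
Section Splice.
Variables (U : zmodType) (t a b c : U) (T A B C : seq U).
Let tT := t :: T. Let aA := a :: A. Let bB := b :: B. Let cC := c :: C.
Let t' := last t T. Let a' := last a A. Let b' := last b B. Let c' := last c C.
Hypothesis uniq_sums : uniq (cycle_sums tT ++ cycle_sums (aA ++ bB ++ cC)).

Let count_sums P : (count P (cycle_sums tT ++ cycle_sums (aA ++ bB ++ cC)) =
  count P (path_sums tT) + count P (path_sums aA) + count P (path_sums bB) +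
  count P (path_sums cC) + count P [:: t' + t; a' + b; b' + c; c' + a]%R)%N.
Proof.
rewrite /aA cycle_sums_cat -/aA [path_sums (b :: _)]path_sums_cat -/bB -/cC.
have -> : cycle_sums tT = rcons (path_sums tT) (t' + t).
  by rewrite /tT /= -!cats1 pairmap_cat.
rewrite -!cats1 !count_cat /= !count_cat /= last_cat /= -/a' -/b' -/c'.
move: (P (t' + t)) (P (a' + b)) (P (b' + c)) (P (c' + a)) => p1 p2 p3 p4.
move: (count P _) (count P _) (count P _) (count P _) => n1 n2 n3 n4.
lia.
Qed.

(** Permuting or reversing the paths keeps the sums inside them, so only the four junction sums need
    to agree as a multiset. Counting with an arbitrary predicate turns this into arithmetic. *)
Let splice A' B' C' : forall x y z X Y Z,
  A' = x :: X -> B' = y :: Y -> C' = z :: Z ->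
  perm_eq (A' ++ B' ++ C') (aA ++ bB ++ cC) ->
  perm_eq (path_sums A' ++ path_sums B' ++ path_sums C')
          (path_sums aA ++ path_sums bB ++ path_sums cC) ->
  perm_eq [:: t' + t; a' + b; b' + c; c' + a]
          [:: t' + x; last x X + y; last y Y + z; last z Z + t] ->
  exists2 s, perm_eq s (tT ++ aA ++ bB ++ cC) & uniq (cycle_sums s).
Proof.
move=> x y z X Y Z eA eB eC pE pS pJ.
exists (tT ++ A' ++ B' ++ C'); first by rewrite perm_cat2l.
rewrite (perm_uniq (_ : perm_eq _ (cycle_sums tT ++ cycle_sums (aA ++ bB ++ cC)))) //.
apply/seq.permP=> P; rewrite count_sums.
have := seq.permP pJ P; have := seq.permP pS P.
rewrite {}eA {}eB {}eC cycle_sums_cat (path_sums_cat x X y) (path_sums_cat y Y z).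
rewrite -!cats1 !count_cat /= !count_cat /= !count_cat /= !last_cat /= !last_cat /= -/t'.
move: (P (t' + t)) (P (a' + b)) (P (b' + c)) (P (c' + a)) => p1 p2 p3 p4.
move: (P (_ + x)) (P (_ + y)) (P (_ + z)) (P (_ + t)) => q1 q2 q3 q4.
move: (count P _) (count P _) (count P _) (count P _) => n1 n2 n3 n4.
move: (count P _) (count P _) (count P _) => m1 m2 m3; clear; lia.
Qed.

Lemma splice_ABC :
  perm_eq [:: t' + t; a' + b; b' + c; c' + a] [:: t' + a; a' + b'; b + c; c' + t] ->
  exists2 s, perm_eq s (tT ++ aA ++ bB ++ cC) & uniq (cycle_sums s).
Proof.
move=> pJ; have [X eB]: exists X, rev bB = b' :: X.
  by rewrite /bB lastI rev_rcons; eexists.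
apply: (splice (erefl aA) eB (erefl cC)); rewrite -?eB ?path_sums_rev.
- by rewrite perm_cat2l perm_cat2r perm_rev.
- by rewrite perm_cat2l perm_cat2r perm_rev.
suff -> : last b' X = b by [].
by have : last b' (rev bB) = b; [rewrite /bB rev_cons last_rcons | rewrite eB].
Qed.

Lemma splice_ACB :
  perm_eq [:: t' + t; a' + b; b' + c; c' + a] [:: t' + a; a' + c'; c + b; b' + t] ->
  exists2 s, perm_eq s (tT ++ aA ++ bB ++ cC) & uniq (cycle_sums s).
Proof.
move=> pJ; have [X eC]: exists X, rev cC = c' :: X.
  by rewrite /cC lastI rev_rcons; eexists.
apply: (splice (erefl aA) eC (erefl bB)); rewrite -?eC ?path_sums_rev.
- by rewrite perm_cat2l perm_catC perm_cat2l perm_rev.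
- by rewrite perm_cat2l perm_catC perm_cat2l perm_rev.
suff -> : last c' X = c by [].
by have : last c' (rev cC) = c; [rewrite /cC rev_cons last_rcons | rewrite eC].
Qed.

End Splice.

Lemma last_map_iota (T : Type) (f : nat -> T) a m :
  last (f a) (map f (iota a.+1 m)) = f (a + m)%N.
Proof. by elim: m a => [|m IHm] a /=; rewrite ?addn0 // IHm addnS. Qed.

Lemma uniq_size_mem (T : finType) (A : {set T}) (s : seq T) :
  uniq s -> {subset s <= A} -> size s = #|A| -> s =i A.
Proof.
move=> us sA sz; apply/subset_cardP; first by rewrite (card_uniqP us) sz.
by apply/subsetP.
Qed.

Lemma eq_of_divn3 k t t' u : (t < 3 * k)%N -> (t' < 3 * k)%N ->
  (t %% 3 = t' %% 3)%N -> (t %/ 3 + u = t' %/ 3 + u %[mod k])%N -> t = t'.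
Proof.
move=> ltt ltt' e3 /eqP; rewrite eqn_modDr !modn_small ?ltn_divLR 1?mulnC //.
by move=> /eqP e; rewrite (divn_eq t 3) (divn_eq t' 3) e e3.
Qed.

Lemma divn3S t : (t.+1 %% 3 = (t %% 3).+1 %% 3 /\
  t.+1 %/ 3 = t %/ 3 + (t %% 3 == 2))%N.
Proof. lia. Qed.

(* Of the two cycles, one runs through K as g i, g (i + 1), ..., and the other
   through P minus K as w + g i, x + g (i + 1), y + g (i + 2), w + g (i + 1), ...
   with w in x + y + K.  Since w and the indices a and i below can be chosen so
   that [e1]-[e4] hold, removing one edge of the first and three of the second
   leaves four paths that reconnect into a single cycle with the same edge sums.
   The path through y is traversed backwards: without a reversal, parity would
   prevent two cycles from merging into one. *)
Lemma klein_step (U : finZmodType) (K P : {group U}) (x y : U) :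
  K \subset P -> #|P| = (4 * #|K|)%N -> (2 < #|K|)%N -> x \in P -> y \in P ->
  x \notin K -> y \notin K -> x + y \notin K -> x *+ 2 \in K -> y *+ 2 \in K ->
  harmonious_set K -> harmonious_set P.
Proof.
move=> sKP cardP K_gt2 xP yP xK yK xyK x2K y2K /harm_periodic[g [gK gmod ginj gsum]].
set k := #|K| in cardP K_gt2 gmod ginj gsum.
have k_gt0 : (0 < k)%N by apply: leq_trans K_gt2.
have sumK j : g j + g j.+1 \in K by rewrite zgroupD.
have gper j : g (j + k)%N = g j by rewrite -gmod modnDr gmod.
have neqmod i j : (i < j)%N -> (j < k)%N -> i = j %[mod k] -> False.
  by move=> ltij ltj; rewrite !modn_small ?(ltn_trans ltij) //; lia.
(* The index [a] is chosen for [e2]: the sum of [g a] and its successor is the double of [g 1]. *)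
have [a lta ea] := periodic_surj sumK gsum (zgroupD (gK 1) (gK 1)).
have [b kE] : exists b, k = (a + b.+1)%N by exists (k - a.+1)%N; lia.
(* If [a] were 0 or 1, then [g 1] would equal a neighbour. Hence the cut at [x + g a] comes after
   the cut at [x + g 1]. *)
have [a0 aE] : exists a0, a = a0.+2.
  case: a lta ea {kE} => [|[|a0]] lta ea; last by exists a0.
    by case: (neqmod 0%N 1%N) => //; [lia | apply: ginj; apply: (addIr (g 1%N))].
  by case: (neqmod 1%N 2%N) => //; apply: ginj; apply: (addrI (g 1%N)).
(* The edge of the cycle on [K] that will be removed; its sum is dictated by [e3]. *)
have [i lti ei] := periodic_surj sumK gsum (zgroupD (zgroupD y2K (gK a.+1)) (gK 2)).
(* The shift [d] of [w] inside its coset is the solution of [e1]. *)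
pose d := g 1%N + g 2%N - g i - g 0%N.
have dK : d \in K by rewrite !zgroupD ?zgroupN.
pose w := x + y + d.
pose p := nth 0 [:: w; x; y].
pose c t := p (t %% 3)%N + g (t %/ 3 + t %% 3)%N.
have xDK z : z \in K -> (x + z \in K) = false by move=> zK; rewrite zgroupDr // (negPf xK).
have yDK z : z \in K -> (y + z \in K) = false by move=> zK; rewrite zgroupDr // (negPf yK).
have xyE : x - y = x + y - y *+ 2 by rewrite mulr2n opprD addrA addrK.
have xyDK : (x - y \in K) = false by rewrite xyE zgroupDr ?zgroupN // (negPf xyK).
have yxDK : (y - x \in K) = false by rewrite -opprB zgroupN.
have pK r : (r < 3)%N -> p r \notin K.
  case: r => [|[|[|r]]] //= _.
  by rewrite /w zgroupDr.
have p_inj r r' : (r < 3)%N -> (r' < 3)%N -> p r - p r' \in K -> r = r'.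
  have E1 : w - x = y + d by rewrite /w -(addrA x) [x + (_ + _)]addrC addrK.
  have E2 : w - y = x + d by rewrite /w [x + y + d]addrAC addrK.
  case: r => [|[|[|r]]] //=; case: r' => [|[|[|r']]] //= _ _.
  - by rewrite E1 yDK.
  - by rewrite E2 xDK.
  - by rewrite -opprB E1 zgroupN yDK.
  - by rewrite xyDK.
  - by rewrite -opprB E2 zgroupN xDK.
  - by rewrite yxDK.
(* The sums of two of the three nontrivial cosets are again the three nontrivial cosets. So a sum on
   the second cycle determines its position modulo 3 and never lies in [K]. *)
pose q r := p r + p (r.+1 %% 3)%N.
have q_inj r r' : (r < 3)%N -> (r' < 3)%N -> q r - q r' \in K -> r = r'.
  have E (s s' z : U) : (z + s) - (s' + z) = s - s'
    by rewrite [s' + z]addrC opprD addrA [z + s]addrC addrK.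
  have E' (s s' z : U) : (z + s) - (z + s') = s - s' by rewrite [z + s']addrC E.
  have E'' (s s' z : U) : (s + z) - (s' + z) = s - s' by rewrite [s + z]addrC E.
  rewrite /q; case: r => [|[|[|r]]] //=; case: r' => [|[|[|r']]] //= _ _.
  - by rewrite [w + x]addrC E' => /(p_inj 0%N 2%N isT isT).
  - by rewrite E => /(p_inj 1%N 2%N isT isT).
  - by rewrite [w + x]addrC E' => /(p_inj 2%N 0%N isT isT).
  - by rewrite [y + w]addrC E'' => /(p_inj 1%N 0%N isT isT).
  - by rewrite [w + x]addrC E'' => /(p_inj 2%N 1%N isT isT).
  - by rewrite E => /(p_inj 0%N 1%N isT isT).
have qK r : (r < 3)%N -> q r \notin K.
  case: r => [|[|[|r]]] //= _; rewrite /q /=.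
  - by rewrite /w addrAC [x + y]addrC -(addrA y x) -mulr2n -addrA yDK // zgroupD.
  - by rewrite /w addrC addrAC -(addrA x y) -mulr2n -addrA xDK // zgroupD.
have lt3 t : (t %% 3 < 3)%N by rewrite ltn_mod.
(* At each of the three positions the [K]-parts of neighbours are values of [g] at consecutive
   indices, the smaller one being [h t], so [gsum] applies. *)
pose h t := (t %/ 3 + (if t %% 3 == 0 then 0 else 1))%N.
have cS t : c t + c t.+1 = q (t %% 3)%N + (g (h t) + g (h t).+1).
  rewrite /c /q /h addrACA; have := lt3 t.
  have [-> ->] := divn3S t; case: (t %% 3)%N => [|[|[|r]]] //= _.
  - by rewrite !addn0 addn1.
  - by rewrite !addn0 addn2 addn1.
  by rewrite !addn1 addn0 addn2 [g _.+2 + _]addrC.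
have split_inj r r' z z' (f : nat -> U) :
    (forall r r', (r < 3)%N -> (r' < 3)%N -> f r - f r' \in K -> r = r') ->
    (r < 3)%N -> (r' < 3)%N -> z \in K -> z' \in K -> f r + z = f r' + z' ->
  r = r' /\ z = z'.
  move=> f_inj r3 r3' zK zK' e.
  have rr' : r = r'.
    apply: f_inj => //; suff -> : f r - f r' = z' - z by rewrite zgroupD ?zgroupN.
    by apply: (addIr z); rewrite subrK addrAC e addrAC subrr add0r.
  by split=> //; move: e; rewrite rr' => /addrI.
have c_inj t t' : (t < 3 * k)%N -> (t' < 3 * k)%N -> c t = c t' -> t = t'.
  move=> ltt ltt' /(split_inj _ _ _ _ _ p_inj); case=> // e3 /ginj.
  by rewrite -e3; apply: eq_of_divn3.
have cs_inj t t' : (t < 3 * k)%N -> (t' < 3 * k)%N ->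
    c t + c t.+1 = c t' + c t'.+1 -> t = t'.
  rewrite !cS => ltt ltt' /(split_inj _ _ _ _ _ q_inj); case=> // e3 /gsum.
  by rewrite /h -e3; apply: eq_of_divn3.
have c3k : c (3 * k)%N = c 0%N.
  by rewrite /c modnMr mulKn // div0n mod0n !addn0 -[g k]gmod modnn.
(* Starting at [i.+1] makes the closing edge of [sT] the one from [g i] to [g i.+1]. *)
pose sT := map g (iota i.+1 k); pose sC := mkseq c (3 * k).
have sTE : sT = mkseq (fun j => g (i.+1 + j)%N) k.
  by rewrite /sT /mkseq -[in LHS](addn0 i.+1) iotaDl -map_comp.
have uT : uniq sT.
  rewrite sTE; apply/mkseq_uniqP => j j' ltj ltj' /ginj/eqP.
  by rewrite eqn_modDl !modn_small // => /eqP.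
have uC : uniq sC by apply/mkseq_uniqP => t t'; apply: c_inj.
have sTK : {subset sT <= K} by move=> _ /mapP[j _ ->].
have ndTC : ~~ has (mem sT) sC.
  apply/hasPn=> _ /mapP[t _ ->]; apply: contra (pK _ (lt3 t)) => /sTK.
  by rewrite zgroupDr.
have uTC : uniq (sT ++ sC) by rewrite cat_uniq uT ndTC.
have KP z : z \in K -> z \in P by apply: subsetP.
have wP : w \in P by apply: (zgroupD (zgroupD xP yP) (KP d dK)).
have pP r : (r < 3)%N -> p r \in P.
  by case: r => [|[|[|r]]].
have defP : sT ++ sC =i P.
  apply: uniq_size_mem => //; last first.
    by rewrite size_cat size_map size_iota size_mkseq cardP -mulSn.
  move=> z; rewrite mem_cat => /orP[/sTK/KP //|/mapP[t _ ->]].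
  by rewrite zgroupD ?pP ?KP.
have csT : cycle_sums sT = mkseq (fun j => g (i.+1 + j)%N + g (i.+1 + j).+1%N) k.
  by rewrite sTE cycle_sums_mkseq ?addn0 ?gper //; apply: eq_map => j; rewrite addnS.
have csC : cycle_sums sC = mkseq (fun t => c t + c t.+1) (3 * k).
  by rewrite cycle_sums_mkseq.
have ucs : uniq (cycle_sums sT ++ cycle_sums sC).
  rewrite csT csC cat_uniq; apply/and3P; split.
  - apply/mkseq_uniqP => j j' ltj ltj' /gsum/eqP.
    by rewrite eqn_modDl !modn_small // => /eqP.
  - apply/hasPn=> _ /mapP[t _ ->]; apply: contra (qK _ (lt3 t)).
    by case/mapP=> j _; rewrite cS => e; rewrite -(zgroupDl _ (sumK (h t))) addrC e sumK.
  by apply/mkseq_uniqP => t t'; apply: cs_inj.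
(* The cuts fall after [x + g 1] and after [x + g a]; the third removed edge is the closing one,
   from [y + g 1] to [w + g 0]. *)
have sCE : sC = (c 0%N :: [:: c 1%N]) ++ (c 2%N :: map c (iota 3 (3 * a0).+2)) ++
               (c (3 * a0 + 5)%N :: map c (iota (3 * a0 + 5).+1 (3 * b + 3))).
  have -> : (c 0%N :: [:: c 1%N]) = map c (iota 0 2) by [].
  have -> : c 2%N :: map c (iota 3 (3 * a0).+2) = map c (iota 2 (3 * a0).+3) by [].
  rewrite (_ : _ :: _ = map c (iota (3 * a0 + 5) (3 * b + 4))); last first.
    by rewrite addn4 addn3.
  rewrite -!map_cat /sC /mkseq; congr (map c _).
  rewrite (_ : 3 * k = 2 + ((3 * a0).+3 + (3 * b + 4)))%N; last by clear -aE kE; lia.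
  rewrite (iotaD 0 2) (iotaD _ (3 * a0).+3); do 2!congr (_ ++ _).
  by congr iota; clear; lia.
have sT_cons : sT = g i.+1 :: map g (iota i.+2 k.-1).
  by rewrite /sT -[in LHS](prednK k_gt0).
rewrite sCE sT_cons in uTC defP ucs.
have [|s ps us] := splice_ACB ucs; last first.
  by apply: (seq_harm _ _ us); [rewrite (perm_uniq ps) | move=> z; rewrite (perm_mem ps) defP].
have cE m r : (r < 3)%N -> c (3 * m + r)%N = p r + g (m + r)%N.
  by move=> r3; rewrite /c mulnC modnMDl divnMDl // modn_small // divn_small // addn0.
have ew : w + g 0%N + g i = x + y + (g 1%N + g 2).
  by rewrite /w /d -!(addrA (x + y)) !subrK.
have e1 : g i + (w + g 0%N) = x + g 1%N + (y + g 2) by rewrite addrC ew addrACA.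
have e2 : x + g 1%N + (y + g 1%N) = x + g a + (y + g a.+1).
  by rewrite addrACA -ea [RHS]addrACA.
have e3 : y + g a.+1 + (y + g 2) = g i + g i.+1 by rewrite ei addrACA mulr2n addrA.
(* The removed and the new edges have the same eight endpoints, hence the same total, so three
   matches force the fourth. *)
have e4 : x + g a + g i.+1 = y + g 1%N + (w + g 0%N).
  apply: (addIr (g i)); rewrite -addrA [g i.+1 + _]addrC ei -[RHS]addrA ew.
  rewrite [LHS](AC (2*3) ((1*3*5)*(2*4))) [RHS](AC (2*(2*2)) ((3*(1*4)*6)*(2*5))) /=.
  by rewrite ea mulr2n.
rewrite !last_map_iota /=.
rewrite addSnnS prednK //.
have -> : (2 + (3 * a0).+2 = 3 * a0.+1 + 1)%N by clear; lia.
have -> : (3 * a0 + 5 + (3 * b + 3) = 3 * (a0 + b + 2) + 2)%N by clear; lia.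
have -> : (3 * a0 + 5 = 3 * a0.+1 + 2)%N by clear; lia.
have -> : c 0%N = w + g 0%N by apply: (cE 0%N 0%N).
have -> : c 1%N = x + g 1%N by apply: (cE 0%N 1%N).
have -> : c 2%N = y + g 2 by apply: (cE 0%N 2%N).
rewrite !cE //= addn1 -aE addn2 -aE gper.
have -> : (a0 + b + 2 + 2 = 1 + k)%N by rewrite kE aE; clear; lia.
rewrite gper e1 e2 e3 e4; apply/seq.permP=> Q /=.
by move: (Q _) (Q _) (Q _) (Q _) => q1 q2 q3 q4; clear; lia.
Qed.

(** * The groups Z_2 + Z_(2s) *)

(** The cycle is the orbit of a point under [f]. Distinct sums become injectivity of a one-step map,
    and transitivity is a separate question. *)
Lemma transitive_map_harm (U : finZmodType) (G : {set U}) (T : finType)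
    (f : T -> T) (phi : T -> U) :
  injective f -> (forall x y, fconnect f x y) -> T ->
  injective phi -> phi @: [set: T] = G ->
  injective (fun x => phi x + phi (f x)) -> harmonious_set G.
Proof.
move=> f_inj f_trans x0 phi_inj defG sum_inj.
have cardG : #|G| = #|T| by rewrite -defG card_imset // cardsT.
have ordT : fingraph.order f x0 = #|T| by apply: eq_card => y; rewrite !inE; apply: f_trans.
have iter_inj i j : (i < #|T|)%N -> (j < #|T|)%N -> iter i f x0 = iter j f x0 -> i = j.
  rewrite -ordT => lti ltj e.
  by rewrite -(findex_iter lti) -(findex_iter ltj) e.
exists (fun i => phi (iter i f x0)); rewrite cardG.
split=> [|i lti|i j lti ltj|i j lti ltj].
- by rewrite -ordT iter_order.
- by rewrite -defG imset_f ?inE.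
- by move/phi_inj; apply: iter_inj.
by move/sum_inj; apply: iter_inj.
Qed.

(* A permutation of Z_2 * Z_(2s): the bit says whether the next step is +1 or +2.
   In the lower half the type of step is kept, in the upper half it alternates;
   hence two residues that differ by s always receive opposite bits, which makes
   t + (image of t) injective. *)
Definition two_speed_step s (t : bool * nat) : bool * nat :=
  let wrap q := if (q < 2 * s)%N then q else (q - 2 * s)%N in
  if t.1 then ((wrap t.2.+1 < s)%N, wrap t.2.+1)
  else (~~ (wrap t.2.+2 < s)%N, wrap t.2.+2).

Lemma two_speed_step_lt s t : (1 < s)%N -> (t.2 < 2 * s)%N ->
  ((two_speed_step s t).2 < 2 * s)%N.
Proof. by case: t => [[] q] /=; case: ifP; lia. Qed.

Lemma two_speed_step_inj s t t' : (1 < s)%N -> (t.2 < 2 * s)%N -> (t'.2 < 2 * s)%N ->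
  two_speed_step s t = two_speed_step s t' -> t = t'.
Proof.
by case: t t' => [[] q] [[] q'] /= s1 lt lt' [] => [_|||_];
  (do 2?case: ifP) => ? ? *; try (congr pair; lia); exfalso; lia.
Qed.

Lemma two_speed_sum_inj s (t t' : bool * nat) :
  (1 < s)%N -> (t.2 < 2 * s)%N -> (t'.2 < 2 * s)%N ->
  (t.1 + (two_speed_step s t).1 = t'.1 + (two_speed_step s t').1 %[mod 2])%N ->
  (t.2 + (two_speed_step s t).2 = t'.2 + (two_speed_step s t').2 %[mod 2 * s])%N ->
  t = t'.
Proof.
move=> s1 lt lt' e1 e2.
(* Both sums are below 4s, so congruence modulo 2s means equality up to one shift by 2s, which
   leaves linear arithmetic. *)
have : (t.2 + (two_speed_step s t).2 = t'.2 + (two_speed_step s t').2 \/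
        t.2 + (two_speed_step s t).2 = t'.2 + (two_speed_step s t').2 + 2 * s \/
        t'.2 + (two_speed_step s t').2 = t.2 + (two_speed_step s t).2 + 2 * s)%N.
  have := two_speed_step_lt s1 lt; have := two_speed_step_lt s1 lt'.
  move: (two_speed_step s t).2 (two_speed_step s t').2 e2 => a b e2 lta ltb.
  have E c d : (c < 2 * s -> d < 2 * s ->
      (c + d) %% (2 * s) = if c + d < 2 * s then c + d else c + d - 2 * s)%N.
    move=> ltc ltd; case: ifP => [|/negbT]; first exact: modn_small.
    rewrite -leqNgt => le; rewrite -{1}(subnK le) modnDr modn_small //; lia.
  move: e2; rewrite !E //; do 2?case: ifP; lia.
move: e1 {e2}; case: t t' lt lt' => [[] q] [[] q'] /= lt lt';
  (do 2?case: ifP) => ? ? *; try (congr pair; lia); exfalso; lia.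
Qed.

(* In the lower half the orbits are (true, _), (false, even) and (false, odd), in
   the upper half they are given by the distance to s modulo 3.  The passage from
   one half to the other merges these into one orbit, unless 3 divides s. *)
Lemma two_speed_reach s (R : bool -> nat -> bool) :
    (3 < s)%N -> ~~ odd s -> ~~ (3 %| s)%N -> R true 0%N ->
    (forall e q, (q < 2 * s)%N ->
       R e q = let r := two_speed_step s (e, q) in R r.1 r.2) ->
  forall e q, (q < 2 * s)%N -> R e q.
Proof.
move=> s3 evs s_n3 R0 Rstep.
have [p sE] : exists p, s = p.+2 by exists s.-2; clear -s3; lia.
have evp : ~~ odd p by move: evs; rewrite sE /= negbK.
have lt_s : (s < 2 * s)%N by clear -s3; lia.
have lt_s2 : (s + 2 < 2 * s)%N by clear -s3; lia.
have lt_sp : (s + p < 2 * s)%N by clear -sE; lia.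
have lt_sp1 : (s + p.+1 < 2 * s)%N by clear -sE; lia.
have s_gt0 : (0 < s)%N by rewrite sE.
have R1 q : (q.+1 < 2 * s)%N -> R true q = R (q.+1 < s)%N q.+1.
  by move=> lt; rewrite (Rstep _ _ (ltnW lt)) /= lt.
have R2 q : (q.+2 < 2 * s)%N -> R false q = R (~~ (q.+2 < s)%N) q.+2.
  by move=> lt; rewrite (Rstep _ _ (ltnW (ltnW lt))) /= lt.
have X q : (q < s)%N -> R true q.
  elim: q => // q IHq lt; rewrite -[true]lt -R1 ?IHq //; lia.
have E q : (q < s)%N -> R false q = R false (odd q).
  elim/ltn_ind: q => -[|[|q]] // IHq lt.
  have ltq : (q.+2 < 2 * s)%N by lia.
  by rewrite /= negbK -IHq ?(R2 _ ltq) ?lt // ltnW // ltnW.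
(* A step by 2 that lands in the upper half is followed by a step by 1. *)
have H3 q : (s <= q.+2)%N -> (q.+3 < 2 * s)%N -> R false q = R false q.+3.
  move=> le lt; rewrite R2 ?(ltnW lt) // ltnNge le R1 //.
  by rewrite ltnNge (leqW le).
have L j : (s + j < 2 * s)%N -> R false (s + j)%N = R false (s + j %% 3)%N.
  elim/ltn_ind: j => -[|[|[|j]]] // IHj lt.
  have lt3 : ((s + j).+3 < 2 * s)%N by move: lt; rewrite !addnS.
  have les : (s <= (s + j).+2)%N by rewrite -addn2 -addnA leq_addr.
  rewrite -addn3 modnDr addnA addn3 -(H3 _ les lt3).
  by apply: IHj; [do 2!apply: leqW | apply: ltnW (ltnW (ltnW lt3))].
have Rs : R false s by have := X p.+1; rewrite R1 -?sE ?ltnn ?lt_s //; apply.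
have lt_p1 : (p.+1 < s)%N by rewrite sE.
(* Leaving the lower half from [p.+1] and [p], the odd class enters class 2 of the upper half and
   the even class enters class 1. *)
have Rs1 : R false 1%N = R false (s + 2)%N.
  have s2E : (s + 2 = p.+4)%N by rewrite sE addn2.
  have <- : R false p.+1 = R false 1%N by rewrite (E _ lt_p1) /= evp.
  by rewrite s2E; apply: H3; rewrite -?s2E // sE.
have Rs0 : R false 0%N = R false (s + 1)%N.
  have s1E : (s + 1 = p.+3)%N by rewrite sE addn1.
  have <- : R false p = R false 0%N by rewrite (E _ (ltnW lt_p1)) (negPf evp).
  by rewrite s1E; apply: H3; [rewrite sE | rewrite -s1E; clear -s3; lia].
(* Wrapping around from the last two residues returns to 0 and 1. *)
have W0 : R false 0%N = R false (s + p %% 3)%N.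
  have wrap0 : ((s + p).+2 = 2 * s)%N by clear -sE; lia.
  by rewrite -(L _ lt_sp) (Rstep _ _ lt_sp) /= wrap0 ltnn subnn s_gt0.
have W1 : R false 1%N = R false (s + p.+1 %% 3)%N.
  have wrap1 : ((s + p.+1).+2 = (2 * s).+1)%N by clear -sE; lia.
  rewrite -(L _ lt_sp1) (Rstep _ _ lt_sp1) /= wrap1.
  have -> : ((2 * s).+1 < 2 * s)%N = false by rewrite ltnNge leqnSn.
  by rewrite subSn // subnn (ltnW (ltnW s3)).
have [Ra Rb] : R false 0%N /\ R false 1%N.
  (* Class 0 of the upper half is reached by [Rs]. In both cases one parity class is joined to it
     and the other parity class to the first. If 3 divided [s], both would return to their own upper
     class. *)
  have [[e1 e2]|[e1 e2]] : (p %% 3 = 2 /\ p.+1 %% 3 = 0 \/ p %% 3 = 0 /\ p.+1 %% 3 = 1)%N.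
  - by move: s_n3; rewrite sE; clear; lia.
  - have R1' : R false 1%N by rewrite W1 e2 addn0.
    by rewrite W0 e1 -Rs1.
  have R0' : R false 0%N by rewrite W0 e1 addn0.
  by rewrite W1 e2 -Rs0.
have RF q : (q < 2 * s)%N -> R false q.
  move=> lt; have [lts|les] := ltnP q s; first by rewrite E //; case: (odd q).
  rewrite -(subnKC les) L ?subnKC //.
  have := ltn_pmod (q - s) (isT : 0 < 3)%N.
  by case: (_ %% 3)%N => [|[|[|]]] //= _; rewrite ?addn0 -?Rs0 -?Rs1.
case=> q lt; last exact: RF.
have [lts|les] := ltnP q s; first exact: X.
have [lt1|le1] := ltnP q.+1 (2 * s); first by rewrite R1 // ltnNge leqW //= RF.
have -> : q = (2 * s).-1 by clear -lt le1; lia.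
by rewrite (Rstep _ _ _) /= ?prednK ?ltnn ?subnn ?s_gt0 //; clear -s_gt0; lia.
Qed.

Lemma two_speed_harm (U : finZmodType) (G : {group U}) (u v : U) s :
  (3 < s)%N -> ~~ odd s -> ~~ (3 %| s)%N -> #[u]%g = 2 -> #[v]%g = (2 * s)%N ->
  (<[u]> \x <[v]>)%g = G -> harmonious_set G.
Proof.
move=> s3 evs s_n3 ou ov defG.
have [cardG sG1 sG2 uniqG] := dprod_zmodP defG.
have s1 : (1 < s)%N by apply: ltn_trans s3.
have s2 : (0 < 2 * s)%N by lia.
have stepL := two_speed_step_lt s1.
pose o : bool * 'I_(2 * s) := (true, Ordinal s2).
pose nat_of (t : bool * 'I_(2 * s)) : bool * nat := (t.1, val t.2).
pose node (r : bool * nat) : bool * 'I_(2 * s) := (r.1, insubd o.2 r.2).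
have nodeK r : (r.2 < 2 * s)%N -> nat_of (node r) = r.
  by case: r => e q lt; rewrite /nat_of /node /= insubdK.
have nat_ofK t : node (nat_of t) = t by case: t => e q; rewrite /node /= valKd.
have nat_of_lt t : ((nat_of t).2 < 2 * s)%N by apply: ltn_ord.
pose f t := node (two_speed_step s (nat_of t)).
have fK t : nat_of (f t) = two_speed_step s (nat_of t) by rewrite nodeK // stepL.
have f_inj : injective f.
  move=> t t' /(congr1 nat_of); rewrite !fK => /(two_speed_step_inj s1) e.
  by rewrite -[t]nat_ofK e // nat_ofK.
pose phi t : U := u *+ (nat_of t).1 + v *+ (nat_of t).2.
have powP i j i' j' : u *+ i + v *+ j = u *+ i' + v *+ j' ->
    (i = i' %[mod 2] /\ j = j' %[mod 2 * s])%N.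
  case/uniqG; rewrite ?mem_cycle // => /eqP; rewrite -!FinRing.zmodXgE.
  by rewrite eq_expg_mod_order ou => /eqP e1 /eqP; rewrite eq_expg_mod_order ov => /eqP.
have phi_inj : injective phi.
  move=> t t' /powP[]; have := nat_of_lt t; have := nat_of_lt t' => lt lt'.
  rewrite [(_.2 %% _)%N]modn_small // [((nat_of t').2 %% _)%N]modn_small // => e1 e2.
  rewrite -[t]nat_ofK -[t']nat_ofK; congr node; move: e1 e2.
  by case: (nat_of t) (nat_of t') => [[] q] [[] q'] //= _ ->.
apply: (transitive_map_harm f_inj _ o phi_inj).
- pose R e q := fconnect f o (node (e, q)).
  have Rstep e q : (q < 2 * s)%N -> R e q = let r := two_speed_step s (e, q) in R r.1 r.2.
    by move=> lt; rewrite /R (same_fconnect1_r f_inj) /f nodeK //=; case: two_speed_step.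
  have Ro : R true 0%N.
    by rewrite /R (_ : node _ = o) ?connect0 //; congr pair; apply/val_inj; rewrite /= insubdK.
  suff RT e q : (q < 2 * s)%N -> R e q.
    have fo t : fconnect f o t.
      by rewrite -(nat_ofK t); apply: (RT _ _ (nat_of_lt t)).
    by move=> t t'; apply: connect_trans (fo t'); rewrite (fconnect_sym f_inj).
  exact: two_speed_reach.
- apply/eqP; rewrite eqEcard card_imset // cardsT card_prod card_bool card_ord cardG.
  rewrite -!orderE ou ov leqnn andbT; apply/subsetP=> _ /imsetP[t _ ->].
  by apply: zgroupD; [apply: (subsetP sG1) | apply: (subsetP sG2)]; apply: mem_cycle.
move=> t t'; rewrite /phi !fK addrACA [RHS]addrACA -!mulrnDr => /powP[e1 e2].
by rewrite -[t]nat_ofK (two_speed_sum_inj s1 _ _ e1 e2) ?nat_of_lt // nat_ofK.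
Qed.

(** * Transport from concrete groups, and the small base cases *)

Definition embeds (A : zmodType) (U : finZmodType) (G : {set U}) : Prop :=
  exists phi : A -> U,
    [/\ injective phi, {morph phi : a b / a + b} & forall a, phi a \in G].

Definition harmonious_seq (A : zmodType) (s : seq A) := uniq s && uniq (cycle_sums s).

(** An embedding carries sums to sums; the length of the sequence then forces its image to be all of
    [G]. *)
Lemma embeds_harm (A : zmodType) (U : finZmodType) (G : {set U}) (s : seq A) :
  embeds A G -> harmonious_seq s -> size s = #|G| -> harmonious_set G.
Proof.
case=> phi [phi_inj phiD phiG] /andP[us ucs] sz.
have psE t a : pairmap +%R (phi a) (map phi t) = map phi (pairmap +%R a t).
  by elim: t a => //= b t IHt a; rewrite phiD IHt.
have csE : cycle_sums (map phi s) = map phi (cycle_sums s).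
  by case: s {us ucs sz} => // a s; rewrite /= -map_rcons psE.
apply: (@seq_harm _ _ (map phi s)); rewrite ?csE ?map_inj_uniq //.
apply: uniq_size_mem; rewrite ?map_inj_uniq ?size_map // => _ /mapP[a _ ->].
exact: phiG.
Qed.

Lemma embeds_dprod (A B : zmodType) (U : finZmodType) (G1 G2 G : {group U}) :
  (G1 \x G2)%g = G -> embeds A G1 -> embeds B G2 -> embeds (A * B)%type G.
Proof.
move=> defG [phi [phi_inj phiD phiG]] [psi [psi_inj psiD psiG]].
have [_ /subsetP sG1 /subsetP sG2 uniqG] := dprod_zmodP defG.
exists (fun ab => phi ab.1 + psi ab.2); split=> [[a b] [a' b'] /=|[a b] [a' b'] /=|[a b] /=].
- by case/uniqG=> // /phi_inj-> /psi_inj->.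
- by rewrite phiD psiD addrACA.
by apply: zgroupD; [apply: sG1 | apply: sG2].
Qed.

Lemma embeds_cycle (U : finZmodType) (x : U) n :
  (1 < n)%N -> #[x]%g = n -> embeds 'Z_n <[x]>%g.
Proof.
move=> n1 ox; have lt_n (a : 'Z_n) : (a < n)%N by rewrite -[X in (_ < X)%N](Zp_cast n1).
exists (fun a : 'Z_n => x *+ a); split=> [a b /eqP|a b|a].
- by rewrite -!FinRing.zmodXgE eq_expg_mod_order ox !modn_small // => /eqP; apply: val_inj.
- have -> : nat_of_ord (a + b) = ((a + b) %% n)%N by congr (_ %% _)%N; apply: Zp_cast.
  rewrite -mulrnDr; apply/eqP.
  by rewrite -!FinRing.zmodXgE eq_expg_mod_order ox modn_mod.
exact: mem_cycle.
Qed.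

(** In orders 8 and 16 a subgroup of index 4 has order 2 or 4 and admits no such arrangement, so
    [klein_step] cannot produce these cases. Explicit lists are checked by computation. *)
Lemma harm_Z4_Z4 : exists2 s : seq ('Z_4 * 'Z_4)%type, harmonious_seq s & size s = 16.
Proof.
pose s : seq (nat * nat) :=
  [:: (0, 0); (0, 1); (0, 2); (1, 0); (0, 3); (1, 1); (1, 2); (2, 0);
      (2, 2); (1, 3); (2, 1); (2, 3); (3, 2); (3, 0); (3, 1); (3, 3)]%N.
by exists [seq (inZp p.1 : 'Z_4, inZp p.2 : 'Z_4) | p <- s].
Qed.

Lemma harm_Z4_Z2 : exists2 s : seq ('Z_4 * 'Z_2)%type, harmonious_seq s & size s = 8.
Proof.
pose s : seq (nat * nat) :=
  [:: (0, 0); (1, 0); (2, 0); (0, 1); (2, 1); (3, 0); (1, 1); (3, 1)]%N.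
by exists [seq (inZp p.1 : 'Z_4, inZp p.2 : 'Z_2) | p <- s].
Qed.

Lemma harm_Z4_Z2_Z2 :
  exists2 s : seq ('Z_4 * ('Z_2 * 'Z_2))%type, harmonious_seq s & size s = 16.
Proof.
pose s : seq (nat * nat * nat) :=
  [:: (0, 0, 0); (0, 0, 1); (0, 1, 0); (1, 0, 0);
      (0, 1, 1); (2, 0, 1); (1, 0, 1); (2, 1, 0);
      (1, 1, 1); (3, 0, 1); (3, 0, 0); (3, 1, 1);
      (2, 1, 1); (3, 1, 0); (1, 1, 0); (2, 0, 0)]%N.
by exists [seq (inZp p.1.1 : 'Z_4, (inZp p.1.2 : 'Z_2, inZp p.2 : 'Z_2)) | p <- s].
Qed.

(** * 2-groups *)

Section TwoGroups.
Variable U : finZmodType.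
Implicit Types (P Q K B : {group U}) (a c x y : U).

Lemma zmod_dprodE P Q : P :&: Q = 1%g -> exists K : {group U}, (P \x Q)%g = K.
Proof.
move=> tiPQ; have cPQ : Q \subset 'C(P)%g.
  by apply/centsP=> x _ y _; apply: addrC.
by exists (P <*> Q)%G; rewrite dprodEY.
Qed.

Lemma mem_zcycle a n : a *+ n \in <[a]>%g.
Proof. exact: mem_cycle. Qed.

Lemma order_double a : ~~ odd #[a]%g -> #[a]%g = (2 * #[a *+ 2]%g)%N.
Proof.
move=> ev; have d2 : (2 %| #[a]%g)%N by rewrite dvdn2.
by rewrite -FinRing.zmodXgE orderXdiv // mulnC divnK.
Qed.

Lemma double_cycle_proper a : ~~ odd #[a]%g -> a \notin <[a *+ 2]>%g.
Proof.
move=> ev; apply/negP; rewrite -cycle_subG => /subset_leq_card.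
rewrite -!orderE (order_double ev) leqNgt ltn_Pmull //.
Qed.

(** [K] is the product of [<[a *+ 2]>], [<[c *+ 2]>] and [B], so that [a] and [c] represent a Klein
    quotient. The listed members of [K] serve to find the invariant [has_Z4_Z2] in it again. *)
Lemma klein_reduce P Q B a c :
    (<[a]> \x Q)%g = P -> (<[c]> \x B)%g = Q ->
    ~~ odd #[a]%g -> ~~ odd #[c]%g ->
  exists2 K : {group U}, [/\ (#|K| < #|P|)%N, K \subset P,
      a *+ 2 \in K, c *+ 2 \in K & B \subset K]
    & (2 < #|K|)%N -> harmonious_set K -> harmonious_set P.
Proof.
move=> defP defQ eva evc.
have [cardP sa sQ uniqP] := dprod_zmodP defP.
have [cardQ sc sB uniqQ] := dprod_zmodP defQ.
have s2a : <[a *+ 2]>%g \subset <[a]>%g by rewrite cycle_subG mem_zcycle.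
have s2c : <[c *+ 2]>%g \subset <[c]>%g by rewrite cycle_subG mem_zcycle.
have [Q' defQ'] : exists Q' : {group U}, (<[c *+ 2]> \x B)%g = Q'.
  apply: zmod_dprodE; apply/trivgP; have [_ _ _ <-] := dprodP defQ.
  exact: setSI.
have [cardQ' sc' sB' _] := dprod_zmodP defQ'.
have sQ'Q : Q' \subset Q.
  have [_ <- _ _] := dprodP defQ'; have [_ <- _ _] := dprodP defQ.
  exact: mulSg.
have [K defK] : exists K : {group U}, (<[a *+ 2]> \x Q')%g = K.
  apply: zmod_dprodE; apply/trivgP; have [_ _ _ <-] := dprodP defP.
  exact: setISS.
have [cardK sa' sQ' _] := dprod_zmodP defK.
have cardPK : #|P| = (4 * #|K|)%N.
  rewrite cardP cardQ cardK cardQ' -!orderE (order_double eva) (order_double evc).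
  by rewrite -[4%N]/(2 * 2)%N -!mulnA; congr (2 * _)%N; rewrite mulnCA; congr (_ * _)%N.
have sKP : K \subset P.
  have [_ <- _ _] := dprodP defK; have [_ <- _ _] := dprodP defP.
  exact: mulgSS.
have KE k : k \in K -> exists k1 k2 k3, [/\ k1 \in <[a *+ 2]>%g, k2 \in <[c *+ 2]>%g,
    k3 \in B & k = k1 + (k2 + k3)].
  have [_ <- _ _] := dprodP defK => /mulsgP[k1 q k1a qQ' ->].
  move: qQ'; have [_ <- _ _] := dprodP defQ' => /mulsgP[k2 k3 k2c k3B ->].
  by exists k1, k2, k3.
have notK x y : x \in <[a]>%g -> y \in <[c]>%g ->
    (x \notin <[a *+ 2]>%g) || (y \notin <[c *+ 2]>%g) -> x + y \notin K.
  move=> xa yc nxy; apply/negP=> /KE[k1 [k2 [k3 [k1a k2c k3B e]]]].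
  have k2c' := subsetP s2c _ k2c.
  have qQ : k2 + k3 \in Q := zgroupD (subsetP sc _ k2c') (subsetP sB _ k3B).
  have [e1 e2] := uniqP _ _ _ _ xa (subsetP s2a _ k1a) (subsetP sc _ yc) qQ e.
  have [e3 _] : y = k2 /\ 0 = k3.
    by apply: uniqQ => //; [apply: group1 | rewrite addr0].
  by move: nxy; rewrite e1 e3 k1a k2c.
have a0 : 0 \in <[a *+ 2]>%g by apply: group1.
have c0 : 0 \in <[c *+ 2]>%g by apply: group1.
exists K; first split=> //.
- by rewrite cardPK ltn_Pmull ?cardG_gt0.
- by apply: (subsetP sa'); apply: cycle_id.
- by apply: (subsetP sQ'); apply: (subsetP sc'); apply: cycle_id.
- exact: subset_trans sB' sQ'.
move=> K2; apply: (klein_step (x := a) (y := c) sKP cardPK K2).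
- by apply: (subsetP sa); apply: cycle_id.
- by apply: (subsetP sQ); apply: (subsetP sc); apply: cycle_id.
- by rewrite -[a]addr0; apply: notK;
    rewrite ?cycle_id ?group1 // ?double_cycle_proper //; apply: group1.
- by rewrite -[c]add0r; apply: notK;
    rewrite ?cycle_id ?group1 // ?double_cycle_proper ?orbT //; apply: group1.
- by apply: notK; rewrite ?cycle_id // double_cycle_proper.
- by apply: (subsetP sa'); apply: cycle_id.
by apply: (subsetP sQ'); apply: (subsetP sc'); apply: cycle_id.
Qed.
(** For a 2-group this means neither cyclic nor elementary abelian. It is the invariant of the
    induction in [two_group_harm]. *)
Definition has_Z4_Z2 P := exists x y,
  [/\ x \in P, y \in P, (4 %| #[x]%g)%N, (2 %| #[y]%g)%N & (<[x]> :&: <[y]>)%g = 1%g].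

Lemma dprodCA (A B C : {set U}) : (A \x (B \x C) = B \x (A \x C))%g.
Proof. by rewrite !dprodA [(B \x A)%g]dprodC. Qed.

Lemma two_group_harm P : (2.-group P)%g -> has_Z4_Z2 P -> harmonious_set P.
Proof.
have [n] := ubnP #|P|; elim: n => // n IHn in P * => leP pP [x0 [y0 [x0P y0P dx0 dy0 tixy0]]].
have step Q B a c : (<[a]> \x Q)%g = P -> (<[c]> \x B)%g = Q ->
    (2 %| #[a]%g)%N -> (2 %| #[c]%g)%N ->
    (forall K, a *+ 2 \in K -> c *+ 2 \in K -> B \subset K -> has_Z4_Z2 K) -> harmonious_set P.
  rewrite !dvdn2 => defP defQ eva evc hK.
  have [K [ltK sKP aK cK BK] harmK] := klein_reduce defP defQ eva evc.
  have HK := hK K aK cK BK; apply: harmK.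
    have [x [y [xK _ dx _ _]]] := HK.
    by apply: (@leq_trans 4) => //; rewrite dvdn_leq // (dvdn_trans dx) // order_dvdG.
  by apply: IHn => //; [apply: leq_trans ltK _; rewrite -ltnS | apply: pgroupS pP].
have [x [P1 [ox defP]]] := cycle_split P.
have [cardP sx sP1 _] := dprod_zmodP defP.
have [y [P2 [oy defP1]]] := cycle_split P1.
have [cardP1 sy sP2 _] := dprod_zmodP defP1.
have order2 g : g \in P -> exists e, #[g]%g = (2 ^ e)%N.
  by move=> gP; have [e eE] := p_natP (mem_p_elt pP gP); exists e.
have xP : x \in P by rewrite (subsetP sx) ?cycle_id.
have yP1 : y \in P1 by rewrite (subsetP sy) ?cycle_id.
have [b ob] := order2 x xP; have [c oc] := order2 y (subsetP sP1 _ yP1).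
have b2 : (1 < b)%N.
  have : (2 ^ 2 %| 2 ^ b)%N by rewrite -ob ox (dvdn_trans dx0) // dvdn_exponent.
  by rewrite dvdn_Pexp2l.
have cb : (c <= b)%N.
  have : (2 ^ c %| 2 ^ b)%N by rewrite -ob -oc ox dvdn_exponent // (subsetP sP1).
  by rewrite dvdn_Pexp2l.
have c_eq0 : c = 0%N -> P1 :=: 1%g.
  move=> c0; apply/eqP; rewrite trivg_exponent -oy oc c0.
  exact: dvdnn.
(* A cyclic group has only one subgroup of order 2, whereas [x0] and [y0] have powers of order 2
   generating different ones. *)
have P1_neq1 : P1 :!=: 1%g.
  apply/eqP=> P11; have cycP : cyclic P.
    by move: defP; rewrite P11 dprodg1 => <-; apply: cycle_cyclic.
  have ev0 : (2 %| #[x0]%g)%N by apply: dvdn_trans dx0.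
  pose x2 := (x0 ^+ (#[x0] %/ 2))%g; pose y2 := (y0 ^+ (#[y0] %/ 2))%g.
  have order_half (g : U) : (2 %| #[g]%g)%N -> #[(g ^+ (#[g] %/ 2))%g]%g = 2.
    move=> d; rewrite orderXdiv ?dvdn_div //.
    by rewrite -{1}(divnK d) mulKn // divn_gt0 // dvdn_leq.
  have : <[x2]>%g == <[y2]>%g.
    rewrite (eq_subG_cyclic cycP) ?cycle_subG ?groupX // -!orderE.
    by rewrite !order_half.
  move=> /eqP exy; have : x2 \in (<[x0]> :&: <[y0]>)%g.
    rewrite inE -[X in _ && X]cycle_subG exy cycle_subG.
    by apply/andP; split; apply: mem_cycle.
  rewrite tixy0 => /set1P x21; have := order_half _ ev0.
  by rewrite -/x2 x21 order1.
have c_gt0 : (0 < c)%N by rewrite lt0n; apply: contra P1_neq1 => /eqP/c_eq0->.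
have dvd_order e k (g : U) : #[g]%g = (2 ^ e)%N -> (k <= e)%N -> (2 ^ k %| #[g]%g)%N.
  by move=> -> ke; rewrite dvdn_exp2l.
have dvd_order2 e k (g : U) : #[g]%g = (2 ^ e)%N -> (k < e)%N -> (2 ^ k %| #[g *+ 2]%g)%N.
  move=> og ke; have ev : ~~ odd #[g]%g by rewrite og oddX; case: (e) ke.
  have := order_double ev; rewrite og; case: e {og ev} ke => // e ke.
  by rewrite expnS => /eqP; rewrite eqn_pmul2l // => /eqP <-; rewrite dvdn_exp2l.
have ti_mem (A B D : {group U}) (g h : U) : (A \x B)%g = D -> g \in A -> h \in B ->
    (<[g]> :&: <[h]>)%g = 1%g.
  move=> defD gA hB; apply/trivgP; have [_ _ _ <-] := dprodP defD.
  by apply: setISS; rewrite cycle_subG.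
have x2x : x *+ 2 \in <[x]>%g := mem_zcycle x 2.
have y2y : y *+ 2 \in <[y]>%g := mem_zcycle y 2.
have y2P1 : y *+ 2 \in P1 by apply: zgroupMn.
have [P21|P2_neq1] := eqVneq (P2 : {set U}) 1%g.
  have defP' : (<[x]> \x <[y]>)%g = P by rewrite -defP -defP1 P21 dprodg1.
  have cardP' : #|P| = (2 ^ b * 2 ^ c)%N.
    by rewrite cardP cardP1 P21 cards1 muln1 -!orderE ob oc.
  have [c_le1|c_gt1] := leqP c 1.
    have c1 : c = 1%N by apply/eqP; rewrite eqn_leq c_le1.
    have [b2e|b_neq2] := eqVneq b 2.
      have [s hs sz8] := harm_Z4_Z2.
      apply: (embeds_harm (embeds_dprod defP' (embeds_cycle (n := 4) _ _)
        (embeds_cycle (n := 2) _ _)) hs) => //; rewrite ?ob ?oc ?b2e ?c1 //.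
      by rewrite sz8 cardP' b2e c1.
    have [e be] : exists e, b = e.+3 by exists (b - 3)%N; clear -b2 b_neq2; lia.
    (* Here 2s is the order of [x], and b > 2 gives s > 3. *)
    apply: (@two_speed_harm _ P y x (2 ^ e.+2)).
    - by rewrite !expnS mulnA leq_pmulr // expn_gt0.
    - by rewrite oddX.
    - by rewrite Euclid_dvdX.
    - by rewrite oc c1.
    - by rewrite ob be expnS.
    by rewrite dprodC.
  (* With two factors and c > 1, both generators are doubled; if b > 2, then [x *+ 2] still has
     order at least 4. *)
  have [b_gt2|b_le2] := ltnP 2 b.
    apply: (step _ _ _ _ defP defP1);
    [exact: (dvd_order _ 1%N _ ob (ltnW b2)) | exact: (dvd_order _ 1%N _ oc) |].
    move=> K xK yK _; exists (x *+ 2), (y *+ 2); split=> //.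
    - exact: (dvd_order2 _ 2 _ ob).
    - exact: (dvd_order2 _ 1%N _ oc).
    exact: (ti_mem _ _ _ _ _ defP).
  have b2e : b = 2 by apply/eqP; rewrite eqn_leq b_le2.
  have c2e : c = 2 by apply/eqP; rewrite eqn_leq c_gt1 -{1}b2e cb.
  have [s hs sz16] := harm_Z4_Z4.
  apply: (embeds_harm (embeds_dprod defP' (embeds_cycle (n := 4) _ _)
    (embeds_cycle (n := 4) _ _)) hs) => //; rewrite ?ob ?oc ?b2e ?c2e //.
  by rewrite sz16 cardP' b2e c2e.
have [z [P3 [oz defP2]]] := cycle_split P2.
have [cardP2 sz sP3 _] := dprod_zmodP defP2.
have zP2 : z \in P2 by rewrite (subsetP sz) ?cycle_id.
have [d od] := order2 z (subsetP sP1 _ (subsetP sP2 _ zP2)).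
have d_gt0 : (0 < d)%N.
  rewrite lt0n; apply: contra P2_neq1 => /eqP d0.
  by rewrite trivg_exponent -oz od d0.
have dc : (d <= c)%N.
  have : (2 ^ d %| 2 ^ c)%N by rewrite -od -oc oy dvdn_exponent // (subsetP sP2).
  by rewrite dvdn_Pexp2l.
have defP1z : (<[z]> \x (<[y]> \x P3))%g = P1 by rewrite dprodCA defP2.
(* From three factors on, two generators are doubled so that an element of order at least 4 and an
   independent one survive: first [x] and [z], keeping [y]. *)
have [b_gt2|b_le2] := ltnP 2 b.
  have [[_ B _ eB] _ _ _] := dprodP defP1z; rewrite eB in defP1z.
  have [_ syB _ _] := dprod_zmodP eB.
  apply: (step _ _ _ _ defP defP1z);
    [exact: (dvd_order _ 1%N _ ob (ltnW b2)) | exact: (dvd_order _ 1%N _ od) |].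
  move=> K xK zK /subsetP BK; exists (x *+ 2), y; split=> //.
  - by apply: BK; rewrite (subsetP syB) ?cycle_id.
  - exact: (dvd_order2 _ 2 _ ob).
  - exact: (dvd_order _ 1%N _ oc).
  exact: (ti_mem _ _ _ _ _ defP).
have b2' := b2; have {}b2 : b = 2 by apply/eqP; rewrite eqn_leq b_le2.
have defPy : (<[y]> \x (<[x]> \x P2))%g = P by rewrite dprodCA defP1.
have defPyz : (<[y]> \x (<[z]> \x (<[x]> \x P3)))%g = P.
  by rewrite (dprodCA <[z]>%g) defP2.
have xK_4 : (4 %| #[x]%g)%N := dvd_order _ 2 _ ob b2'.
have yK_2 : (2 %| #[y]%g)%N := dvd_order _ 1%N _ oc c_gt0.
(* Now [x] has order 4 and must be kept; if [y] has order 4 as well, [y] and [z] are doubled. *)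
have [c_gt1|c_le1] := ltnP 1 c.
  have [[_ Q _ eQ] _ _ _] := dprodP defPyz; rewrite eQ in defPyz.
  have [[_ B _ eB] _ _ _] := dprodP eQ; rewrite eB in eQ.
  have [_ sxB _ _] := dprod_zmodP eB.
  apply: (step _ _ _ _ defPyz eQ) => //; first exact: (dvd_order _ 1%N _ od).
  move=> K yK zK /subsetP BK; exists x, (y *+ 2); split=> //.
  - by apply: BK; rewrite (subsetP sxB) ?cycle_id.
  - exact: (dvd_order2 _ 1%N _ oc).
  exact: (ti_mem _ _ _ _ _ defP (cycle_id x)).
have c1 : c = 1%N by apply/eqP; rewrite eqn_leq c_le1.
have d1 : d = 1%N by apply/eqP; rewrite eqn_leq -{1}c1 dc.
have [P31|P3_neq1] := eqVneq (P3 : {set U}) 1%g.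
  have defP2' : (<[z]>)%g = P2 by rewrite -defP2 P31 dprodg1.
  have emb2 : embeds ('Z_2 * 'Z_2)%type P1.
    apply: (embeds_dprod defP1); first by apply: embeds_cycle; rewrite // oc c1.
    by rewrite -defP2'; apply: embeds_cycle; rewrite // od d1.
  have [s hs sz16] := harm_Z4_Z2_Z2.
  apply: (embeds_harm (embeds_dprod defP (embeds_cycle (n := 4) _ _) emb2) hs) => //.
    by rewrite ob b2.
  by rewrite sz16 cardP cardP1 -defP2' -!orderE ob oc od b2 c1 d1.
(* A fourth factor makes it possible to double [z] and [w] and keep both [x] and [y]. *)
have [w [P4 [ow defP3]]] := cycle_split P3.
have [_ sw _ _] := dprod_zmodP defP3.
have wP3 : w \in P3 by rewrite (subsetP sw) ?cycle_id.
have [e oe] := order2 w (subsetP sP1 _ (subsetP sP2 _ (subsetP sP3 _ wP3))).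
have e_gt0 : (0 < e)%N.
  rewrite lt0n; apply: contra P3_neq1 => /eqP e0.
  by rewrite trivg_exponent -ow oe e0.
have defPzw : (<[z]> \x (<[w]> \x (<[x]> \x (<[y]> \x P4))))%g = P.
  rewrite (dprodCA <[w]>%g) (dprodCA <[w]>%g) defP3 (dprodCA <[z]>%g) (dprodCA <[z]>%g).
  by rewrite defP2 defP1.
have [[_ Q _ eQ] _ _ _] := dprodP defPzw; rewrite eQ in defPzw.
have [[_ B _ eB] _ _ _] := dprodP eQ; rewrite eB in eQ.
have [xB yB] : x \in B /\ y \in B.
  have [[_ C _ eC] _ _ _] := dprodP eB; rewrite eC in eB.
  have [_ sxB /subsetP sCB _] := dprod_zmodP eB.
  have [_ syC _ _] := dprod_zmodP eC.
  split; first by apply: (subsetP sxB); apply: cycle_id.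
  by apply: sCB; apply: (subsetP syC); apply: cycle_id.
apply: (step _ _ _ _ defPzw eQ);
  [exact: (dvd_order _ 1%N _ od) | exact: (dvd_order _ 1%N _ oe) |].
move=> K zK wK /subsetP BK; exists x, y; split=> //; [exact: BK | exact: BK |].
exact: (ti_mem _ _ _ _ _ defP (cycle_id x)).
Qed.
End TwoGroups.

(** * Elementary abelian 2-groups times odd cyclic groups *)

Lemma map_iota_cons (T : Type) (f : nat -> T) a b : (a <= b)%N ->
  map f (iota a (b.+1 - a)) = f a :: map f (iota a.+1 (b - a)).
Proof. by move=> le; rewrite subSn. Qed.

(* The first of two cycles on F * Z_q is {0} * Z_q and the second runs q steps of
   Z_q for each power of the generator g, up to the correction [kappa] of a single
   layer.  Along the layers j = 0, ..., 2k the exponent of g first decreases and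
   then increases, so that it has gone up by one after a full turn. *)
Section FieldTimesCyclic.
Variables (F : fieldType) (g : F) (M k : nat).
Hypotheses (char2 : 2%N \in [pchar F]) (M_gt1 : (1 < M)%N) (k_gt0 : (0 < k)%N).
Hypothesis g_inj : forall a b, g ^+ a = g ^+ b -> a = b %[mod M].
Hypothesis g_per : g ^+ M = 1.

Let q := k.*2.+1.
Let n := (M * q)%N.
(** This equals g^k + g^(k+1), as the exchange [sum_cc0q] requires. The correction is added to both
    cycles, so it cancels whenever values or sums over the same residue are compared. *)
Let kap : F := (1 + g) * g ^+ k.
Let kappa j : F := if j == k.+1 then kap else 0.
Let m j := (if j < k then k - j.+1 else j - k)%N.
Let v t : F := g ^+ (t %/ q + ((k - t %% q) + (t %% q - k)))%N.
Let c t : F * 'Z_q := (v t + kappa (t %% q)%N, inZp t).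
Let z j : F * 'Z_q := (kappa (j %% q)%N, inZp j).
Let ks j := kappa (j %% q)%N + kappa (j.+1 %% q)%N.

Let q_gt1 : (1 < q)%N. Proof. by rewrite /q ltnS double_gt0. Qed.
Let q_gt0 : (0 < q)%N. Proof. exact: ltnW. Qed.
Let M_gt0 : (0 < M)%N. Proof. exact: ltnW. Qed.

Let addFF (x : F) : x + x = 0. Proof. by rewrite addrr_pchar2. Qed.

Let g_neq0 : g != 0.
Proof.
by apply: contraTneq (oner_neq0 F) => g0; rewrite -g_per g0 expr0n gtn_eqF // negbK.
Qed.

Let g1_neq0 : 1 + g != 0.
Proof.
apply/eqP => e; have : g ^+ 1 = g ^+ 0.
  by rewrite expr1 expr0; apply: (addrI 1); rewrite e addFF.
by move/g_inj; rewrite mod0n modn_small.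
Qed.

Let g_expS a : g ^+ a + g ^+ a.+1 = (1 + g) * g ^+ a.
Proof. by rewrite exprS -{1}[g ^+ a]mul1r -mulrDl. Qed.

Let g_expSr a : g ^+ a.+1 + g ^+ a = (1 + g) * g ^+ a.
Proof. by rewrite addrC g_expS. Qed.

Let inZp_inj i j : inZp i = inZp j :> 'Z_q -> i = j %[mod q].
Proof. by move/(congr1 val); rewrite /= Zp_cast. Qed.

Let inZpD i j : inZp i + inZp j = inZp (i + j) :> 'Z_q.
Proof. by apply/val_inj; rewrite /= Zp_cast // modnDm. Qed.

Let inZp_eq i j : i = j %[mod q] -> inZp i = inZp j :> 'Z_q.
Proof. by move=> e; apply/val_inj; rewrite /= Zp_cast. Qed.

Let double_inj i j : i.*2.+1 = j.*2.+1 %[mod q] -> i = j %[mod q].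
Proof.
rewrite -(addn1 i.*2) -(addn1 j.*2) -!mul2n => /eqP; rewrite eqn_modDr => e.
have cop : coprime 2 q by rewrite coprime2n /= odd_double.
wlog le_ij : i j e / (i <= j)%N.
  by case: (leqP i j) => [|/ltnW] le H; [apply: H | apply/esym/H => //; rewrite eq_sym].
apply/eqP; rewrite eq_sym eqn_mod_dvd //.
by rewrite eq_sym eqn_mod_dvd ?leq_mul // -mulnBr Gauss_dvdr 1?coprime_sym in e.
Qed.

(** Neighbouring exponents differ by one, so in either direction 1 + g times the lower power
    appears; [m] is the lower exponent relative to the round. *)
Let vS t : v t + v t.+1 = (1 + g) * g ^+ (t %/ q + m (t %% q)%N)%N.
Proof.
rewrite /v /m modnS divnS //; have lt := ltn_pmod t q_gt0.
case: ifP => [dv|ndv].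
  have e : (t %% q).+1 = q.
    have : (q %| (t %% q).+1)%N by rewrite /dvdn -addn1 modnDml addn1.
    by move/dvdn_leq=> /(_ isT) le; apply/eqP; rewrite eqn_leq lt.
  have -> : (t %% q = k.*2)%N by move: e => [].
  have -> : (k.*2 < k)%N = false by rewrite ltnNge -addnn leq_addr.
  have [-> ->] : (k - k.*2 = 0 /\ k.*2 - k = k)%N by clear; lia.
  by rewrite subn0 sub0n addn0 add0n add1n addSn g_expS.
rewrite add0n; move: (t %% q)%N (t %/ q)%N => j r; case: (ltnP j k) => [ltj|lej].
  have -> : (k - j = (k - j.+1).+1)%N by rewrite subnSK.
  have [-> ->] : (j - k = 0 /\ j.+1 - k = 0)%N by split; apply/eqP; rewrite subn_eq0 // ltnW.
  by rewrite !addn0 addnS g_expSr.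
have [-> ->] : (k - j = 0 /\ k - j.+1 = 0)%N by split; apply/eqP; rewrite subn_eq0 // ltnW.
by rewrite !add0n subSn // addnS g_expS.
Qed.

Let csE t : c t + c t.+1 = ((1 + g) * g ^+ (t %/ q + m (t %% q)%N)%N + ks t, inZp t.*2.+1).
Proof.
rewrite /c; congr pair; first by rewrite /= addrACA vS.
by rewrite /= inZpD addnS addnn.
Qed.

Let zsE t : z t + z t.+1 = (ks t, inZp t.*2.+1).
Proof. by rewrite /z; congr pair; rewrite /= inZpD addnS addnn. Qed.

Let c_inj t t' : c t = c t' -> t = t' %[mod n].
Proof.
move=> e; have /= e1 := congr1 fst e; have /inZp_inj e2 := congr1 snd e.
apply: eqn_mod_mul => //.
move: e1; rewrite /v e2 => /addIr/g_inj/eqP; rewrite eqn_modDr => /eqP; exact.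
Qed.

Let cs_inj t t' : c t + c t.+1 = c t' + c t'.+1 -> t = t' %[mod n].
Proof.
rewrite !csE => e; have /= e1 := congr1 fst e.
have /inZp_inj/double_inj e2 := congr1 snd e; apply: eqn_mod_mul => //.
have eS : t.+1 = t'.+1 %[mod q] by rewrite -addn1 -modnDml e2 modnDml addn1.
move: e1; rewrite /ks eS e2 => /addIr/(mulfI g1_neq0)/g_inj/eqP.
by rewrite eqn_modDr => /eqP.
Qed.

Let c_per t : c (t + n)%N = c t.
Proof.
rewrite [(t + n)%N]addnC /n /c /v modnMDl divnMDl // -addnA exprD g_per mul1r.
by congr pair; apply: inZp_eq; rewrite modnMDl.
Qed.

Let z_inj i j : z i = z j -> i = j %[mod q].
Proof. by move=> e; have /inZp_inj := congr1 snd e. Qed.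

Let zs_inj i j : z i + z i.+1 = z j + z j.+1 -> i = j %[mod q].
Proof. by rewrite !zsE => e; have /inZp_inj/double_inj := congr1 snd e. Qed.

Let z_per j : z (j + q)%N = z j.
Proof. by rewrite /z modnDr; congr pair; apply: inZp_eq; rewrite modnDr. Qed.

Let zc_neq i t : z i <> c t.
Proof.
move=> e; have /inZp_inj e2 := congr1 snd e; have /eqP := congr1 fst e.
by rewrite /= e2 -subr_eq0 opprD addrCA subrr addr0 oppr_eq0 expf_eq0 (negPf g_neq0) andbF.
Qed.

Let zcs_neq i t : z i + z i.+1 <> c t + c t.+1.
Proof.
rewrite zsE csE => e; have /inZp_inj/double_inj e2 := congr1 snd e.
have eS : i.+1 = t.+1 %[mod q] by rewrite -addn1 -modnDml e2 modnDml addn1.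
have /eqP := congr1 fst e.
rewrite /= /ks e2 eS -subr_eq0 opprD addrCA subrr addr0 oppr_eq0 mulf_eq0 (negPf g1_neq0).
by rewrite expf_eq0 (negPf g_neq0) andbF.
Qed.

Variables (rho X Y : nat).
(* The second cycle is cut after the positions L, X and Y, that is after layer
   k + 1 of round rho and after layer 0 of the rounds 0 and 1. *)
Let L := (rho * q + k.+1)%N.
Hypothesis rhoE : g ^+ rho.+1 = (1 + g) * g ^+ k.-1.
Hypotheses (LX : (L < X)%N) (XY : (X < Y)%N) (YL : (Y < L + n)%N).
Hypothesis XYE : (X, Y) = (q, n) \/ (X, Y) = (n, n + q)%N.

Let sT := map z (iota k.+1 q).
Let sC := map c (iota L.+1 n).

Let modn_shift a b i j : (i < b)%N -> (j < b)%N -> (a + i = a + j %[mod b])%N -> i = j.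
Proof. by move=> lti ltj /eqP; rewrite eqn_modDl !modn_small // => /eqP. Qed.

Let sTE : sT = mkseq (fun i => z (k.+1 + i)%N) q.
Proof. by rewrite /sT /mkseq -[in LHS](addn0 k.+1) iotaDl -map_comp. Qed.

Let sCE : sC = mkseq (fun i => c (L.+1 + i)%N) n.
Proof. by rewrite /sC /mkseq -[in LHS](addn0 L.+1) iotaDl -map_comp. Qed.

Let uniq_elts : uniq (sT ++ sC).
Proof.
rewrite cat_uniq sTE sCE; apply/and3P; split.
- by apply/mkseq_uniqP => i j lti ltj /z_inj/modn_shift; apply.
- by apply/hasPn=> _ /mapP[t _ ->]; apply/mapP=> -[i _ /esym]; apply: zc_neq.
by apply/mkseq_uniqP => i j lti ltj /c_inj/modn_shift; apply.
Qed.

Let uniq_sums : uniq (cycle_sums sT ++ cycle_sums sC).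
Proof.
have -> : cycle_sums sT = mkseq (fun i => z (k.+1 + i)%N + z (k.+1 + i).+1) q.
  by rewrite sTE cycle_sums_mkseq ?addn0 ?z_per //; apply: eq_map => i; rewrite addnS.
have -> : cycle_sums sC = mkseq (fun i => c (L.+1 + i)%N + c (L.+1 + i).+1) n.
  by rewrite sCE cycle_sums_mkseq ?addn0 ?c_per //; apply: eq_map => i; rewrite addnS.
rewrite cat_uniq; apply/and3P; split.
- by apply/mkseq_uniqP => i j lti ltj /zs_inj/modn_shift; apply.
- by apply/hasPn=> _ /mapP[t _ ->]; apply/mapP=> -[i _ /esym]; apply: zcs_neq.
by apply/mkseq_uniqP => i j lti ltj /cs_inj/modn_shift; apply.
Qed.
Let k1q : (k.+1 < q)%N. Proof. by rewrite /q; move: k_gt0; clear; lia. Qed.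

Let kappa_neq j : (j %% q != k.+1 %% q)%N -> kappa (j %% q)%N = 0.
Proof. by rewrite /kappa [(k.+1 %% q)%N]modn_small // => /negPf->. Qed.

Let c0E : c 0%N = (g ^+ k, inZp 0).
Proof. by rewrite /c /v div0n mod0n subn0 sub0n addn0 /kappa /= addr0. Qed.

Let cqE : c q = (g ^+ k.+1, inZp 0).
Proof.
rewrite /c /v divnn q_gt0 modnn subn0 sub0n addn0 /kappa /= addr0.
by congr pair; apply: inZp_eq; rewrite modnn mod0n.
Qed.

Let mod1q : (1 %% q = 1)%N. Proof. by rewrite modn_small. Qed.

Let kappa1 : kappa 1 = 0.
Proof. by rewrite /kappa eqSS eq_sym eqn0Ngt k_gt0. Qed.

Let c1E : c 1%N = (g ^+ k.-1, inZp 1).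
Proof.
rewrite /c /v mod1q kappa1 addr0 divn_small // subn1.
by have -> : (1 - k = 0)%N; [apply/eqP; rewrite subn_eq0 | rewrite addn0].
Qed.

Let cqSE : c q.+1 = (g ^+ k, inZp 1).
Proof.
have e1 : (q.+1 %% q = 1)%N by rewrite -addn1 modnDl mod1q.
have eD : (q.+1 %/ q = 1)%N by rewrite -addn1 divnDl // divnn q_gt0 divn_small // addn0.
rewrite /c /v e1 kappa1 addr0 eD subn1.
have -> : (1 - k = 0)%N by apply/eqP; rewrite subn_eq0.
rewrite addn0 add1n prednK //; congr pair; apply: inZp_eq.
by rewrite e1 mod1q.
Qed.

Let LdivE : (L %/ q = rho)%N.
Proof. by rewrite /L divnMDl // divn_small // addn0. Qed.

Let LmodE : (L %% q = k.+1)%N.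
Proof. by rewrite /L modnMDl modn_small. Qed.

Let vLE : v L = g ^+ rho.+1.
Proof.
rewrite /v LdivE LmodE; have -> : (k - k.+1 = 0)%N by apply/eqP; rewrite subn_eq0.
by rewrite add0n subSnn addn1.
Qed.

Let cLE : c L = (g ^+ rho.+1 + kap, inZp k.+1).
Proof.
rewrite /c vLE LmodE /kappa eqxx; congr pair; apply: inZp_eq.
by rewrite LmodE modn_small.
Qed.

Let cLSE : c L.+1 = (g ^+ rho.+2, inZp k.+2).
Proof.
have modLS : (L.+1 = k.+2 %[mod q])%N by rewrite /L -addnS modnMDl.
rewrite /c kappa_neq ?addr0; last first.
  rewrite modLS -(addn1 k.+1) -[X in _ != X %[mod _]](addn0 k.+1) eqn_modDl mod1q.
  by rewrite mod0n.
congr pair; last exact: inZp_eq.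
have := vS L; rewrite vLE LdivE LmodE /m ltnNge leqnSn /= subSnn addn1 -g_expS.
exact: addrI.
Qed.

Let z_kS : z k.+1 = (kap, inZp k.+1).
Proof. by rewrite /z modn_small // /kappa eqxx. Qed.

Let z_k : z k = (0, inZp k).
Proof. by rewrite /z modn_small ?(ltn_trans _ k1q) // /kappa ltn_eqF. Qed.

Let gk : g ^+ k = g * g ^+ k.-1. Proof. by rewrite -exprS prednK. Qed.

Let inZp_q i j : i = (j + q)%N -> inZp i = inZp j :> 'Z_q.
Proof. by move=> ->; apply: inZp_eq; rewrite modnDr. Qed.

(** This and the next three identities match each new edge with a removed one. They rest on
    characteristic 2, on [rhoE] and on the value of [kap]; the second components agree because q =
    2k + 1. *)
Let sum_zcL : z k + c L.+1 = c q + c q.+1.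
Proof.
rewrite z_k cLSE cqE cqSE; congr pair; rewrite /= ?inZpD; last first.
  by apply: inZp_q; rewrite add0n /q -addnn; clear; lia.
by rewrite add0r [LHS]exprS rhoE [RHS]g_expSr gk; ring.
Qed.

Let sum_cc0q : c 0%N + c q = z k + z k.+1.
Proof.
rewrite c0E cqE z_k z_kS; congr pair; rewrite /= ?inZpD; last first.
  by apply/esym/inZp_q; rewrite add0n /q -addnn; clear; lia.
by rewrite add0r; apply: g_expS.
Qed.

Let sum_cc1q : c 1%N + c q.+1 = c L + c L.+1.
Proof.
rewrite c1E cqSE cLE cLSE; congr pair; rewrite /= ?inZpD; last first.
  by apply/esym/inZp_q; rewrite /q -addnn; clear; lia.
rewrite [g ^+ rho.+2]exprS rhoE /kap gk.
transitivity (g ^+ k.-1 + g * g ^+ k.-1 + (1 + g) * g ^+ k.-1 * (g + g)); last by ring.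
by rewrite addFF mulr0 addr0.
Qed.

Let sum_cLz : c L + z k.+1 = c 0%N + c 1%N.
Proof.
rewrite cLE z_kS c0E c1E; congr pair; rewrite /= ?inZpD; last first.
  by apply: inZp_q; rewrite add0n /q -addnn; clear; lia.
by rewrite -addrA addFF addr0 rhoE -{2}(prednK k_gt0) g_expSr.
Qed.

Lemma spliced_harmonious_seq :
  exists2 s : seq (F * 'Z_q), harmonious_seq s & size s = (M.+1 * q)%N.
Proof.
have sTE' : sT = z k.+1 :: map z (iota k.+2 k.*2) by [].
have sCE' : sC = (c L.+1 :: map c (iota L.+2 (X - L.+1))) ++
   (c X.+1 :: map c (iota X.+2 (Y - X.+1))) ++
   (c Y.+1 :: map c (iota Y.+2 (L + n - Y.+1))).
  rewrite -!map_iota_cons // -!map_cat /sC !subSS; congr (map c _).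
  rewrite {1}(_ : n = (X - L) + ((Y - X) + (L + n - Y)))%N; last first.
    by move: LX XY YL; clear; lia.
  by rewrite !iotaD !addSn !subnKC // ltnW.
have us := uniq_sums; have ue := uniq_elts; rewrite sTE' sCE' in us.
have [|s ps ucs] := splice_ABC us; last first.
  rewrite -sCE' -sTE' in ps.
  exists s; first by rewrite /harmonious_seq (perm_uniq ps) ue.
  by rewrite (perm_size ps) size_cat !size_map !size_iota mulSn.
rewrite !last_map_iota !subnKC //.
have -> : (k.+1 + k.*2 = k + q)%N by rewrite addSnnS.
rewrite !c_per z_per.
have XYS : (X.+1, Y.+1) = (q.+1, n.+1) \/ (X.+1, Y.+1) = (n.+1, (n + q).+1)%N.
  by case: XYE => -[-> ->]; [left | right].
rewrite sum_zcL sum_cLz.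
have cn : c n = c 0%N by rewrite -[n]add0n c_per.
have cnS : c n.+1 = c 1%N by rewrite -[n.+1]add1n c_per.
have cnq : c (n + q)%N = c q by rewrite addnC c_per.
have cnqS : c (n + q).+1 = c q.+1 by rewrite -addnS addnC c_per.
case: XYE => -[-> ->]; rewrite ?cn ?cnS ?cnq ?cnqS.
  rewrite [c q + c 0%N]addrC sum_cc0q [c q.+1 + c 1%N]addrC sum_cc1q.
  apply/seq.permP=> Q /=.
  by move: (Q _) (Q _) (Q _) (Q _) => q1 q2 q3 q4; clear; lia.
rewrite sum_cc0q sum_cc1q; apply/seq.permP=> Q /=.
by move: (Q _) (Q _) (Q _) (Q _) => q1 q2 q3 q4; clear; lia.
Qed.
End FieldTimesCyclic.

Lemma finField_generator (F : finFieldType) : exists g : F,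
  [/\ forall a b, g ^+ a = g ^+ b -> a = b %[mod #|F|.-1],
      g ^+ #|F|.-1 = 1 & forall x, x != 0 -> exists a, x = g ^+ a].
Proof.
have /cyclicP[u defu] := field_unit_group_cyclic [set: {unit F}].
have ou : #[u]%g = #|F|.-1 by rewrite -card_finField_unit defu.
have valX a : val (u ^+ a)%g = val u ^+ a by rewrite FinRing.val_unitX.
exists (val u); split=> [a b e|| x x0].
- apply/eqP; rewrite -ou -eq_expg_mod_order; apply/eqP/val_inj.
  by rewrite /= !valX.
- by rewrite -valX -ou expg_order.
have ux : x \is a GRing.unit by rewrite unitfE.
have : FinRing.unit F ux \in <[u]>%g by rewrite -defu inE.
by case/cycleP=> a e; exists a; rewrite -valX -e.
Qed.

Lemma field_cyclic_harmonious_seq (F : finFieldType) q :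
  2%N \in [pchar F] -> (2 < #|F|)%N -> odd q -> (1 < q)%N ->
  exists2 s : seq (F * 'Z_q), harmonious_seq s & size s = (#|F| * q)%N.
Proof.
move=> ch2 F_gt2 oddq q1; have [g [g_inj g_per g_surj]] := finField_generator F.
have F_gt0 : (0 < #|F|)%N by apply: leq_trans F_gt2.
have FE := prednK F_gt0.
have M1 : (1 < #|F|.-1)%N by rewrite -ltnS FE.
have [k qE] : exists k, q = k.*2.+1.
  by exists q./2; rewrite -[LHS]odd_double_half oddq.
have k0 : (0 < k)%N by move: q1; rewrite qE ltnS double_gt0.
have M0 : (0 < #|F|.-1)%N by apply: ltnW.
have g0 : g != 0.
  by apply: contraTneq (oner_neq0 F) => g0; rewrite -g_per g0 expr0n gtn_eqF // negbK.
have g1 : 1 + g != 0.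
  apply/eqP => e; have : g ^+ 1 = g ^+ 0.
    by rewrite expr1 expr0; apply: (addrI 1); rewrite e addrr_pchar2.
  by move/g_inj; rewrite mod0n modn_small.
have [a ea] := g_surj _ (mulf_neq0 g1 (expf_neq0 k.-1 g0)).
(* [rho.+1] must be congruent to the discrete logarithm [a]; adding [#|F|.-2] subtracts one modulo
   [#|F|.-1]. *)
have [rho lt_rho rhoE] :
    exists2 rho : nat, (rho < #|F|.-1)%N & g ^+ rho.+1 = (1 + g) * g ^+ k.-1.
  exists ((a + #|F|.-2) %% #|F|.-1)%N; first by rewrite ltn_mod.
  by rewrite exprS expr_mod // -exprS -addnS prednK // exprD g_per mulr1 -ea.
subst q; rewrite (_ : #|F| * k.*2.+1 = #|F|.-1.+1 * k.*2.+1)%N; last by rewrite FE.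
pose n := (#|F|.-1 * k.*2.+1)%N.
(* The second cycle is read from just after [L]. If [rho] is 0, the cut at [q] is met before the one
   at 0, which appears as [n]; otherwise [L] lies beyond [q] and the order is reversed. *)
have [rho0|rho_gt0] := posnP rho.
  apply: (@spliced_harmonious_seq _ g _ k ch2 M1 k0 g_inj g_per rho k.*2.+1 n) => //.
  - by rewrite rho0 mul0n add0n; clear -k0; lia.
  - by rewrite /n ltn_Pmull.
  - by rewrite rho0 mul0n add0n -/n; clear; lia.
  by left.
apply: (@spliced_harmonious_seq _ g _ k ch2 M1 k0 g_inj g_per rho n (n + k.*2.+1)%N) => //.
- have : (rho.+1 * k.*2.+1 <= n)%N by rewrite leq_mul2r lt_rho orbT.
  by rewrite mulSn; move: (rho * _)%N n => x y; clear -k0; lia.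
- by rewrite -[X in (X < _)%N]addn0 ltn_add2l.
- rewrite -/n addnC ltn_add2r; case: rho rho_gt0 {lt_rho rhoE} => // r _.
  by rewrite mulSn -addnA -[X in (X < _)%N]addn0 ltn_add2l addnS.
by right.
Qed.

(** The additive group of [F] is elementary abelian, and such groups are determined by their
    order. *)
Lemma embeds_abelem (F : finFieldType) (U : finZmodType) (P : {group U}) :
  2%N \in [pchar F] -> (2.-abelem P)%g -> #|P| = #|F| -> embeds F P.
Proof.
move=> ch2 abP cardP.
have : ([set: F] \isog P)%g.
  rewrite (isog_abelem_card _ (fin_ring_pchar_abelem ch2)) abP cardP cardsT eqxx //.
case/isogP=> f injf imf; exists f; split=> [a b e|a b|a].
- by apply: (injmP injf); rewrite ?inE.
- by apply: morphM; rewrite inE.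
by rewrite -imf mem_morphim ?inE.
Qed.

Lemma elementary_harm (U : finZmodType) (P O H : {group U}) :
  (P \x O)%g = H -> (2.-abelem P)%g -> (2 < #|P|)%N -> odd #|O| ->
  O :!=: 1%g -> harmonious_set H.
Proof.
move=> defH abP P_gt2 oddO O_neq1.
have [x [L [ox defO]]] := cycle_split O.
have [cardO _ _ _] := dprod_zmodP defO.
have [oddx oddL] : odd #[x]%g /\ odd #|L| by apply/andP; rewrite -oddM -cardO.
have x_gt1 : (1 < #[x]%g)%N.
  rewrite ltn_neqAle order_gt0 andbT eq_sym; apply: contra O_neq1 => /eqP x1.
  by rewrite trivg_exponent -ox x1.
have defH' : ((P \x <[x]>) \x L)%g = H by rewrite -dprodA defO.
have [[Q _ defQ _] _ _ _] := dprodP defH'; rewrite defQ in defH'.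
apply: (harm_dprod defH') => //; last exact: odd_harm.
have [[//|m] cardP] := p_natP (abelem_pgroup abP); first by rewrite cardP in P_gt2.
have [F ch2 cardF] := pPrimePowerField (isT : prime 2) (ltn0Sn m).
have [cardQ _ _ _] := dprod_zmodP defQ.
have [|s hs sz] := field_cyclic_harmonious_seq ch2 _ oddx x_gt1; first by rewrite cardF -cardP.
apply: (embeds_harm (embeds_dprod defQ (embeds_abelem ch2 abP _)
    (embeds_cycle x_gt1 erefl)) hs).
  by rewrite cardP cardF.
by rewrite sz cardQ cardP cardF.
Qed.

(** * The case of even order *)

Lemma Z2_Z2s_harm (U : finZmodType) (H K : {group U}) s :
  (1 < s)%N -> K \subset H -> (K \isog [set: ('Z_2 * 'Z_(2 * s))%type])%g -> harmonious_set H.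
Proof.
move=> s1 sKH; rewrite isog_sym => /isogP[f injf imf].
have s2 : (1 < 2 * s)%N by clear -s1; lia.
pose gT := ('Z_2 * 'Z_(2 * s))%type.
pose e1 : gT := (1, 0); pose e2 : gT := (0, 1).
have mulE (x y : gT) : (x * y)%g = (x.1 + y.1, x.2 + y.2) by [].
have e1X i : (e1 ^+ i)%g = (i%:R, 0).
  by elim: i => // i IHi; rewrite expgS IHi mulE /= addr0 -mulrS.
have e2X i : (e2 ^+ i)%g = (0, i%:R).
  by elim: i => // i IHi; rewrite expgS IHi mulE /= addr0 -mulrS.
have natr_dvd m i : (1 < m)%N -> (i%:R == 0 :> 'Z_m) = (m %| i)%N.
  by move=> m1; rewrite -val_eqE /= val_Zp_nat.
have order_eqP (x : gT) m : (forall i, (x ^+ i == 1)%g = (m %| i)%N) -> #[x]%g = m.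
  move=> xE; apply/eqP; rewrite eqn_dvd order_dvdn xE dvdnn /=.
  by rewrite -xE expg_order.
have oe1 : #[e1]%g = 2.
  by apply: order_eqP => i; rewrite e1X -natr_dvd // xpair_eqE eqxx andbT.
have oe2 : #[e2]%g = (2 * s)%N.
  by apply: order_eqP => i; rewrite e2X -natr_dvd // xpair_eqE eqxx.
pose a := f e1; pose t := f e2.
have fH x : f x \in H by rewrite (subsetP sKH) // -imf mem_morphim ?inE.
have oa : #[a]%g = 2 by rewrite order_injm ?inE.
have ot : #[t]%g = (2 * s)%N by rewrite order_injm ?inE.
have at_ : a \notin <[t]>%g.
  apply/negP=> /cycleP[i]; rewrite /t -morphX ?inE // => /(injmP injf).
  by rewrite e2X => /(_ (in_setT _) (in_setT _))/(congr1 fst).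
(* The involution of [<[t]>]. As [a] lies outside [<[t]>], there are two subgroups of order 2, so
   the 2-part [P] is not cyclic. *)
pose b := (t ^+ s)%g.
have ob : #[b]%g = 2 by rewrite orderXdiv ot ?dvdn_mull // mulnK // ltnW.
have ab : <[a]>%g != <[b]>%g.
  apply: contra at_ => /eqP eab; rewrite -cycle_subG eab cycle_subG; exact: mem_cycle.
have abH : abelian H := FinRing.zmod_abelian H.
have nilH := abelian_nil abH.
have defH := nilpotent_pcoreC 2%N nilH.
pose P := 'O_(2%N)(H)%G; pose O := 'O_(2%N)^'(H)%G.
rewrite -[pcore _ H]/(gval P) -[X in (_ \x X)%g]/(gval O) in defH.
have pP : (2.-group P)%g := pcore_pgroup _ _.
have p'O : ((2%N)^'.-group O)%g := pcore_pgroup _ _.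
have oddO : odd #|O| by rewrite -[odd _]negbK -dvdn2 -p'natE.
have memP x : x \in H -> #[x]%g = 2 -> x \in P.
  move=> xH ox; rewrite (mem_normal_Hall (nilpotent_pcore_Hall 2%N nilH)) ?pcore_normal //.
  by rewrite /p_elt ox pnat_id.
have aP : a \in P := memP _ (fH e1) oa.
have bP : b \in P := memP _ (groupX s (fH e2)) ob.
have [/existsP[u /andP[uP /eqP ou]]|no4] := boolP [exists u, (u \in P) && (#[u]%g == 4)].
  apply: (harm_dprod defH) => //; last exact: odd_harm.
  apply: two_group_harm => //.
  (* The cyclic group [<[u]>] cannot contain both [a] and [b]. *)
  suff [v vP /andP[/eqP ov vu]] : exists2 v, v \in P & (#[v]%g == 2) && (v \notin <[u]>%g).
    exists u, v; rewrite ou ov setIC prime_TIg //; first by rewrite -orderE ov.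
    by rewrite cycle_subG.
  have [au|au] := boolP (a \in <[u]>%g); last by exists a; rewrite // oa.
  exists b; rewrite // ob /=; apply: contra ab => bu.
  by rewrite (eq_subG_cyclic (cycle_cyclic u)) ?cycle_subG // -!orderE oa ob.
have abP : (2.-abelem P)%g.
  apply/abelemP=> //; split=> [|x xP]; first exact: FinRing.zmod_abelian.
  have [e oe] := p_natP (mem_p_elt pP xP).
  case: e oe => [|[|e]] oe; try by apply/eqP; rewrite -order_dvdn oe.
  case/existsP: no4; exists (x ^+ (2 ^ e))%g; rewrite groupX //=.
  rewrite -(addn2 e) expnD in oe.
  by rewrite orderXdiv oe ?dvdn_mulr // mulKn ?expn_gt0.
apply: (elementary_harm defH) => //.
  rewrite ltnNge; apply: contra ab => P2.
  have sub x : x \in P -> #[x]%g = 2 -> <[x]>%g = P.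
    by move=> xP ox; apply/eqP; rewrite eqEcard cycle_subG xP -orderE ox.
  by rewrite !sub.
(* If [O] were trivial, [t] of order 2s > 2 would lie in an elementary abelian 2-group. This is
   where s > 1 excludes an elementary abelian [H]. *)
apply/eqP=> O1; move: defH; rewrite O1 dprodg1 => defH.
have tP : t \in P by move: (fH e2); rewrite -[in X in X -> _]defH.
have [_ /(_ t tP)/eqP] := abelemP (isT : prime 2) abP.
rewrite -order_dvdn ot => /dvdn_leq => /(_ isT); rewrite leqNgt.
by rewrite -[X in (X < _)%N]muln1 ltn_pmul2l // s1.
Qed.

(** * Superwheels *)

Lemma coset_representatives (U : finZmodType) (H : {group U}) k :
  #|U| = (#|H| * k.+1)%N ->
  exists r : 'I_k -> U, (forall j, r j \notin H) /\
    (forall i j, r i - r j \in H -> i = j).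
Proof.
move=> cardU; pose S := rcosets H [set: U] :\ (H : {set U}).
have cardS : #|S| = k.
  have HS : (H : {set U}) \in rcosets H [set: U].
    by apply/rcosetsP; exists 1%g; rewrite ?inE // mulg1.
  have := cardsD1 (H : {set U}) (rcosets H [set: U]).
  rewrite HS add1n -/S => e; apply: succn_inj; rewrite -e.
  apply/eqP; rewrite -(eqn_pmul2l (cardG_gt0 H)) -cardU -cardsT.
  by rewrite Lagrange ?subsetT.
pose A j : {set U} := enum_val (cast_ord (esym cardS) j).
have AS j : A j \in S := enum_valP _.
have Ar j : A j = (H :* repr (A j))%g.
  have /setD1P[_ /rcosetsP[x _ ->]] := AS j.
  by rewrite rcoset_repr.
exists (fun j => repr (A j)); split=> [j|i j].
  have /setD1P[/eqP neqH _] := AS j; apply/negP => rH; apply: neqH.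
  by rewrite Ar rcoset_id.
move=> rij; have eA : A i = A j.
  by rewrite Ar (Ar j); apply/rcoset_eqP; rewrite mem_rcoset.
by apply/(@cast_ord_inj _ _ (esym cardS))/enum_val_inj.
Qed.

Lemma harm_superwheel (U : finZmodType) (H : {group U}) k n :
  (2 < n)%N -> #|H| = n -> #|U| = (n * k.+1)%N -> harmonious_set H ->
  harmonious (superwheel k n) U.
Proof.
move=> n3 cardH cardU [g]; rewrite cardH => -[gn gH g_inj gs_inj].
have [|r [rH r_inj]] := @coset_representatives U H k; first by rewrite cardH.
pose f (x : superwheel k n) : U := match x with inl i => g i | inr j => r j end.
have ordSE (i : 'I_n) : g (ordS i) = g i.+1.
  rewrite /=; have := ltn_ord i; rewrite leq_eqVlt => /predU1P[->|lt].
    by rewrite modnn gn.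
  by rewrite modn_small.
have ordS_neq (i : 'I_n) : i != ordS i.
  rewrite -val_eqE /=; have := ltn_ord i; rewrite leq_eqVlt => /predU1P[e|lt].
    by rewrite e modnn; clear -n3 e; lia.
  by rewrite modn_small // ltn_eqF.
(* Edges are indexed by rim positions and spokes. Since [L] is injective on indices, equal labels
   give equal indices and hence equal edges. *)
pose E (t : 'I_n + 'I_n * 'I_k) : {set superwheel k n} :=
  match t with
  | inl i => [set inl i; inl (ordS i)]
  | inr (i, j) => [set inl i; inr j]
  end.
pose L (t : 'I_n + 'I_n * 'I_k) : U :=
  match t with inl i => g i + g i.+1 | inr (i, j) => g i + r j end.
have E_edge t : E t \in edges (superwheel k n).
  case: t => [i|[i j]]; apply/imsetP.
    by exists (inl i, inl (ordS i)); rewrite ?inE //= /cycle_adj ordS_neq eqxx.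
  by exists (inl i, inr j); rewrite ?inE.
have E_surj e : e \in edges (superwheel k n) -> exists t, e = E t.
  case/imsetP=> -[[i|j] [i'|j']]; rewrite inE //= => adj_xy ->.
  - case/andP: adj_xy => _ /orP[/eqP->|/eqP->]; first by exists (inl i).
    by exists (inl i'); apply: setUC.
  - by exists (inr (i, j')).
  by exists (inr (i', j)); apply: setUC.
have EL t : edge_label f (E t) = L t.
  case: t => [i|[i j]]; rewrite edge_labelE //= ?ordSE //.
  by rewrite /cycle_adj ordS_neq eqxx.
have gsH i : (i < n)%N -> g i + g i.+1 \in H.
  by move=> lt; apply: zgroupD; [apply: gH | rewrite -(ordSE (Ordinal lt)); apply: gH].
have grH i j : (i < n)%N -> g i + r j \notin H.
  by move=> lt; rewrite zgroupDl ?gH.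
have L_inj : injective L.
  case=> [i|[i j]] [i'|[i' j']] /= e.
  - congr inl; apply: val_inj; exact: gs_inj (ltn_ord _) (ltn_ord _) e.
  - by have := grH i' j' (ltn_ord _); rewrite -e gsH.
  - by have := grH i j (ltn_ord _); rewrite e gsH.
  have ej : j = j'.
    apply: r_inj; suff -> : r j - r j' = g i' - g i.
      by rewrite zgroupD ?zgroupN ?gH.
    by apply: (addrI (g i)); rewrite addrA e addrK addrC subrK.
  move: e; rewrite ej => /addIr e; congr (inr (_, _)); apply: val_inj.
  exact: g_inj (ltn_ord _) (ltn_ord _) e.
(* There are n + nk indices, exactly the order of the group. *)
have L_surj u : exists t, u = L t.
  have : u \in codom L.
    apply: inj_card_onto => //.
    by rewrite card_sum card_prod !card_ord cardU mulnS.
  by case/codomP=> t ->; exists t.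
exists f; split.
- case=> [i|j] [i'|j'] /= e.
  + congr inl; apply: val_inj; exact: g_inj (ltn_ord _) (ltn_ord _) e.
  + by have := rH j'; rewrite -e gH.
  + by have := rH j; rewrite e gH.
  by congr inr; apply: r_inj; rewrite e subrr group1.
- move=> e e' /E_surj[t ->] /E_surj[t' ->]; rewrite !EL => /L_inj->; by [].
apply/setP=> u; rewrite inE; have [t ->] := L_surj u.
by apply/imsetP; exists (E t); rewrite ?EL.
Qed.

Theorem theorem5p1 (k n : nat) (Gamma : finZmodType) (H : {group Gamma}) :
  (1 <= k)%N -> (3 <= n)%N ->
  #|Gamma| = (n * (k + 1))%N ->
  #|H| = n ->
  (odd n \/
   (~~ odd n /\
    exists (s : nat) (K : {group Gamma}),
      [/\ (2 <= s)%N, K \subset H &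
          K \isog [set: ('Z_2 * 'Z_(2 * s))%type] ])) ->
  harmonious (superwheel k n) Gamma.
Proof.
move=> _ n3 cardGamma cardH hyp; apply: (harm_superwheel n3 cardH).
  by rewrite cardGamma addn1.
case: hyp => [oddn | [_ [s [K [s2 sKH isoK]]]]]; last exact: Z2_Z2s_harm isoK.
by apply: odd_harm; rewrite cardH.
Qed.
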